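(* Let $p$ be a prime and let $\mathbb K$ be a subfield of $\overline{\mathbb F}_p$. For a formal power series $A\in\mathfrak m=X\mathbb K[[X]]$, the following are equivalent: (i) $A$ is algebraic over $\mathbb K(X)$; (ii) $\exp_!(A)$ is algebraic over $\mathbb K(X)$.
   Context: The map $\exp_!:\mathfrak m\to 1+\mathfrak m$ is defined as follows: for $A=\sum_{n\ge1}\alpha_nX^n$, write $\exp\left(\sum_{n\ge 1}\alpha_n\frac{X^n}{n!}\right)=1+\sum_{n\ge1}\beta_n\frac{X^n}{n!}$ and set $\exp_!(A)=1+\sum_{n\ge1}\beta_nX^n$. Each $\beta_n$ is given by a universal polynomial with nonnegative integer coefficients in $\alpha_1,\dots,\alpha_n$ (computed formally over $\mathbb Z$), so this makes sense over any field. *)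

(* Defs.v *)
From HB Require Import structures.
From mathcomp Require Import all_boot all_order all_algebra.
From mathcomp Require Import boolp mpoly.

Set Implicit Arguments.
Unset Strict Implicit.
Unset Printing Implicit Defensive.

Import GRing.Theory Num.Theory.
Local Open Scope ring_scope.

Record fps (R : Type) := Fps { fps_coef :> nat -> R }.

Lemma fpsP (R : Type) (A B : fps R) : A =1 B -> A = B.
Proof. by case: A B => [a] [b] /= /funext ->. Qed.

HB.instance Definition _ (R : Type) := gen_eqMixin (fps R).
HB.instance Definition _ (R : Type) := gen_choiceMixin (fps R).

Section FpsZmodule.
Variable R : comNzRingType.
Implicit Types A B C : fps R.

Definition fps_zero : fps R := Fps (fun=> 0).
Definition fps_opp A : fps R := Fps (fun n => - A n).
Definition fps_add A B : fps R := Fps (fun n => A n + B n).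

Let addA : associative fps_add.
Proof. by move=> A B C; apply: fpsP => n /=; rewrite addrA. Qed.
Let addC : commutative fps_add.
Proof. by move=> A B; apply: fpsP => n /=; rewrite addrC. Qed.
Let add0 : left_id fps_zero fps_add.
Proof. by move=> A; apply: fpsP => n /=; rewrite add0r. Qed.
Let addN : left_inverse fps_zero fps_opp fps_add.
Proof. by move=> A; apply: fpsP => n /=; rewrite addNr. Qed.

HB.instance Definition _ := GRing.isZmodule.Build (fps R) addA addC add0 addN.

End FpsZmodule.

Section FpsRing.
Variable R : comNzRingType.
Implicit Types A B C : fps R.

Definition fps_one : fps R := Fps (fun n => (n == 0%N)%:R).
Definition fps_mul A B : fps R := Fps (fun n => \sum_(i < n.+1) A i * B (n - i)%N).

(* The ring laws are transported from {poly R} through truncation. *)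
Let trunc N A : {poly R} := \poly_(i < N) A i.

Let mul_trunc N A B n : (n < N)%N -> fps_mul A B n = (trunc N A * trunc N B)`_n.
Proof.
move=> nN; rewrite coefM; apply: eq_bigr => i _; rewrite !coef_poly.
by rewrite (leq_ltn_trans _ nN) ?(leq_ltn_trans _ nN) ?leq_subr // -ltnS.
Qed.

Let mulC : commutative fps_mul.
Proof. by move=> A B; apply: fpsP => n; rewrite !(@mul_trunc n.+1) // mulrC. Qed.

Let mulA : associative fps_mul.
Proof.
move=> A B C; apply: fpsP => n.
transitivity (trunc n.+1 A * (trunc n.+1 B * trunc n.+1 C))`_n.
  rewrite coefM; apply: eq_bigr => i _.
  by rewrite coef_poly ltn_ord -mul_trunc // ltnS leq_subr.
rewrite mulrA coefM; apply: eq_bigr => i _.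
by rewrite [(trunc _ C)`_ _]coef_poly ltnS leq_subr -mul_trunc.
Qed.

Let mul1 : left_id fps_one fps_mul.
Proof.
move=> A; apply: fpsP => n /=; rewrite big_ord_recl mul1r subn0 big1 ?addr0 //.
by move=> i _; rewrite mul0r.
Qed.

Let mulDl : left_distributive fps_mul (@fps_add R).
Proof.
move=> A B C; apply: fpsP => n /=; rewrite -big_split /=.
by apply: eq_bigr => i _; rewrite mulrDl.
Qed.

Let one_neq0 : fps_one != 0.
Proof. by apply/eqP => /(congr1 (@fps_coef R)) /(congr1 (@^~ 0%N)) /eqP; rewrite oner_eq0. Qed.

HB.instance Definition _ :=
  GRing.Zmodule_isComNzRing.Build (fps R) mulA mulC mul1 mulDl one_neq0.

Lemma fps_coef0 n : (0 : fps R) n = 0. Proof. by []. Qed.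
Lemma fps_coef1 n : (1 : fps R) n = (n == 0%N)%:R. Proof. by []. Qed.
Lemma fps_coefD A B n : (A + B) n = A n + B n. Proof. by []. Qed.
Lemma fps_coefN A n : (- A) n = - A n. Proof. by []. Qed.
Lemma fps_coefM A B n : (A * B) n = \sum_(i < n.+1) A i * B (n - i)%N.
Proof. by []. Qed.

Definition fps_unit : pred (fps R) := fun A => `[< exists B, B * A == 1 >].
Definition fps_inv A : fps R :=
  if pselect (exists B, B * A == 1) is left ex then xchoose ex else A.

Let mulV : {in fps_unit, left_inverse 1 fps_inv *%R}.
Proof.
move=> A /asboolP exB; rewrite /fps_inv; case: pselect => // ex.
exact/eqP/(xchooseP ex).
Qed.
Let unitPl A B : B * A = 1 -> fps_unit A.
Proof. by move=> BA; apply/asboolP; exists B; apply/eqP. Qed.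
Let inv_out : {in [predC fps_unit], fps_inv =1 id}.
Proof. by move=> A /asboolP nex; rewrite /fps_inv; case: pselect. Qed.

HB.instance Definition _ :=
  GRing.ComNzRing_hasMulInverse.Build (fps R) mulV unitPl inv_out.

End FpsRing.

Section FpsIdomain.
Variable R : idomainType.

Let neq0_order (A : fps R) : A != 0 ->
  exists2 n, A n != 0 & forall i, (i < n)%N -> A i = 0.
Proof.
move=> A0; have exA : exists n, A n != 0.
  apply: contrapT => nex; case/eqP: A0; apply: fpsP => n.
  by apply: contrapT => /eqP An; apply: nex; exists n.
case: (ex_minnP exA) => n An minn; exists n => // i lt_in.
by apply/eqP; apply: contraTT lt_in => Ai; rewrite -leqNgt minn.
Qed.

Let fps_idomain (A B : fps R) : A * B = 0 -> (A == 0) || (B == 0).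
Proof.
move=> AB0; apply: contraT; rewrite negb_or => /andP[].
move=> /neq0_order[a Aa Alt] /neq0_order[b Bb Blt].
have := congr1 (fun C : fps R => C (a + b)%N) AB0.
rewrite fps_coefM fps_coef0 (bigD1 (inord a)) //= inordK ?ltnS ?leq_addr //.
rewrite addKn big1 ?addr0 => [/eqP|i ne_ia].
  by rewrite mulf_eq0 (negPf Aa) (negPf Bb).
have [lt_ia|lt_ai|eq_ia] := ltngtP i a; first by rewrite Alt ?mul0r.
  by rewrite Blt ?mulr0 // ltn_subLR ?ltn_add2r // -ltnS.
by case/eqP: ne_ia; apply: val_inj; rewrite /= inordK ?eq_ia ?ltnS ?leq_addr.
Qed.

HB.instance Definition _ := GRing.ComUnitRing_isIntegral.Build (fps R) fps_idomain.

End FpsIdomain.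

Definition fps_of_poly (R : comNzRingType) (P : {poly R}) : fps R :=
  Fps (fun n => P`_n).

Section FpsOfPoly.
Variable R : comNzRingType.

Let fps_of_poly_zmod : zmod_morphism (@fps_of_poly R).
Proof. by move=> P Q; apply: fpsP => n; rewrite /= coefB. Qed.
Let fps_of_poly_monoid : monoid_morphism (@fps_of_poly R).
Proof.
split; first by apply: fpsP => n; rewrite /= coef1.
by move=> P Q; apply: fpsP => n; rewrite /= coefM.
Qed.

HB.instance Definition _ :=
  GRing.isZmodMorphism.Build {poly R} (fps R) (@fps_of_poly R) fps_of_poly_zmod.
HB.instance Definition _ :=
  GRing.isMonoidMorphism.Build {poly R} (fps R) (@fps_of_poly R) fps_of_poly_monoid.

Lemma fps_of_poly_inj : injective (@fps_of_poly R).
Proof.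
by move=> P Q eqPQ; apply/polyP => n; apply: (congr1 (fun A : fps R => A n) eqPQ).
Qed.

End FpsOfPoly.

Notation ratfun K := {fraction {poly K}}.
Notation laurent K := {fraction (fps K)}.

Notation fps_to_laurent := (@FracField.tofrac (fps _)).

Lemma tofrac_ratio (R : idomainType) (x : {ratio R}) :
  \pi_{fraction R}%qT x = FracField.tofrac \n_x / FracField.tofrac \d_x.
Proof.
apply: (canRL (mulfK _)); first by rewrite tofrac_eq0 denom_ratioP.
apply: esym; rewrite !piE.
apply/eqmodP; rewrite /= FracField.equivfE /FracField.mulf.
by rewrite !numden_Ratio ?mulr1 ?mul1r ?oner_neq0 ?denom_ratioP.
Qed.

(* The inclusion K(X) -> K((X)) = Frac K[[X]]; it does not depend on the chosen
   representative, see ratfun_to_laurentE. *)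
Definition ratfun_to_laurent (K : fieldType) (x : ratfun K) : laurent K :=
  fps_to_laurent (fps_of_poly \n_(repr x)) / fps_to_laurent (fps_of_poly \d_(repr x)).

Section RatfunToLaurent.
Variable K : fieldType.
Local Notation phi := (@fps_of_poly K).
Local Notation "x %:F" := (FracField.tofrac x).

Let phi_neq0 (d : {poly K}) : d != 0 -> (phi d)%:F != 0.
Proof. by rewrite tofrac_eq0 (raddf_eq0 _ (@fps_of_poly_inj K)). Qed.

Let tofrac_neq0 (d : {poly K}) : d != 0 -> d%:F != 0.
Proof. by rewrite tofrac_eq0. Qed.

Lemma ratfun_to_laurentE (n d : {poly K}) :
  d != 0 -> ratfun_to_laurent (n%:F / d%:F) = (phi n)%:F / (phi d)%:F.
Proof.
move=> d0; rewrite /ratfun_to_laurent; set x := n%:F / d%:F.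
have dx0 : \d_(repr x) != 0 := denom_ratioP _.
have : x = (\n_(repr x))%:F / (\d_(repr x))%:F by rewrite -tofrac_ratio reprK.
rewrite {1}/x => /eqP; rewrite eqr_div ?tofrac_neq0 // -!tofracM tofrac_eq => /eqP nd.
by apply/eqP; rewrite eqr_div ?phi_neq0 // -!tofracM -!rmorphM nd.
Qed.

Lemma ratfun_to_laurent_poly (P : {poly K}) : ratfun_to_laurent P%:F = (phi P)%:F.
Proof.
have := ratfun_to_laurentE P (oner_neq0 _).
by rewrite !rmorph1 !divr1.
Qed.

Let ratfunW (T : ratfun K -> Prop) :
  (forall n d : {poly K}, d != 0 -> T (n%:F / d%:F)) -> forall x, T x.
Proof. by move=> Tnd x; rewrite -[x]reprK tofrac_ratio; apply/Tnd/denom_ratioP. Qed.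

Let ratfun_to_laurent_zmod : zmod_morphism (@ratfun_to_laurent K).
Proof.
elim/ratfunW=> n d d0; elim/ratfunW=> m e e0.
rewrite -mulNr addf_div ?tofrac_neq0 // mulNr -!tofracM -tofracB.
rewrite !ratfun_to_laurentE ?mulf_neq0 // rmorphB !rmorphM /= tofracB !tofracM.
by rewrite -[in RHS]mulNr addf_div ?phi_neq0 // mulNr.
Qed.

Let ratfun_to_laurent_monoid : monoid_morphism (@ratfun_to_laurent K).
Proof.
split; first by rewrite -tofrac1 ratfun_to_laurent_poly !rmorph1.
elim/ratfunW=> n d d0; elim/ratfunW=> m e e0.
rewrite mulf_div -!tofracM !ratfun_to_laurentE ?mulf_neq0 //.
by rewrite mulf_div -!tofracM -!rmorphM.
Qed.

HB.instance Definition _ := GRing.isZmodMorphism.Build (ratfun K) (laurent K)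
  (@ratfun_to_laurent K) ratfun_to_laurent_zmod.
HB.instance Definition _ := GRing.isMonoidMorphism.Build (ratfun K) (laurent K)
  (@ratfun_to_laurent K) ratfun_to_laurent_monoid.

End RatfunToLaurent.

Definition fps_algebraic (K : fieldType) (A : fps K) : Prop :=
  algebraicOver (@ratfun_to_laurent K) (fps_to_laurent A).

(* exp(F) = \sum_k F^k / k!, for F without constant term: F^k then only
   contributes in degrees >= k. *)
Definition fps_exp (R : comAlgType rat) (F : fps R) : fps R :=
  Fps (fun n => \sum_(k < n.+1) (k`!%:R : rat)^-1 *: (F ^+ k) n).

Section FpsExpRec.
Variable R : comAlgType rat.
Implicit Types A B F : fps R.

Let D A : fps R := Fps (fun n => A n.+1 *+ n.+1).

Let D_mul A B : D (A * B) = D A * B + A * D B.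
Proof.
pose t n C : {poly R} := \poly_(i < n.+2) (C : fps R) i.
have coef_t n C i : (i < n.+2)%N -> (t n C)`_i = C i by rewrite coef_poly => ->.
apply: fpsP => n; transitivity ((t n A * t n B)^`()`_n).
  rewrite coef_deriv coefM /=; congr (_ *+ _).
  by apply: eq_bigr => i _; rewrite !coef_t // ltnS leq_subr.
rewrite derivM coefD !coefM fps_coefD !fps_coefM.
congr (_ + _); apply: eq_bigr => i _; rewrite coef_deriv !coef_t //=.
- exact: leq_ltn_trans (leq_subr _ _) (leqnSn _).
- by rewrite ltnS ltn_ord.
- by rewrite !ltnS leq_subr.
- by rewrite ltnW // ltnS ltn_ord.
Qed.

Let D_exp A k : D (A ^+ k.+1) = (A ^+ k * D A) *+ k.+1.
Proof.
elim: k => [|k IHk]; first by rewrite expr1 expr0 mul1r.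
by rewrite exprS D_mul IHk mulrnAr mulrA -exprS [D A * _]mulrC -mulrS.
Qed.

Let exp_low F k n : F 0%N = 0 -> (n < k)%N -> (F ^+ k) n = 0.
Proof.
move=> F0; elim: k n => // k IHk n lt_nk; rewrite exprS fps_coefM big1 // => i _.
have [->|i0] := posnP i; first by rewrite F0 mul0r.
have le_in : (i <= n)%N by rewrite -ltnS.
rewrite IHk ?mulr0 // ltn_subLR //.
by apply: leq_trans lt_nk _; rewrite -add1n leq_add2r.
Qed.

Lemma fps_exp_rec F n : F 0%N = 0 ->
  fps_exp F n.+1 *+ n.+1 = \sum_(i < n.+1) F i.+1 *+ i.+1 * fps_exp F (n - i)%N.
Proof.
move=> F0; rewrite /= big_ord_recl expr0 fps_coef1 scaler0 add0r -sumrMnl.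
transitivity (\sum_(k < n.+1) (k`!%:R : rat)^-1 *: (D F * F ^+ k) n).
  apply: eq_bigr => k _; rewrite lift0 scalerMnr.
  have -> : (F ^+ k.+1) n.+1 *+ n.+1 = D (F ^+ k.+1) n by [].
  rewrite D_exp mulrC; set G := D F * F ^+ k.
  have -> m : (G *+ m) n = G n *+ m by elim: m => // m IHm; rewrite !mulrS -IHm.
  rewrite -scaler_nat scalerA; congr (_ *: _).
  by rewrite factS natrM invfM mulrC mulVKf ?pnatr_eq0.
transitivity (\sum_(k < n.+1) \sum_(i < n.+1)
    (k`!%:R : rat)^-1 *: (D F i * (F ^+ k) (n - i)%N)).
  by apply: eq_bigr => k _; rewrite scaler_sumr.
rewrite exchange_big; apply: eq_bigr => i _ /=; rewrite mulr_sumr.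
rewrite (big_ord_widen n.+1 (fun k => F i.+1 *+ i.+1 * ((k`!%:R : rat)^-1 *: (F ^+ k) (n - i)%N))).
  rewrite [RHS]big_mkcond; apply: eq_bigr => k _.
  by case: ltnP => [_|?]; rewrite scalerAr // exp_low ?scaler0 ?mulr0.
by rewrite ltnS leq_subr.
Qed.

End FpsExpRec.

(* \sum_(1 <= m <= n) alpha_m X^m / m!, where alpha_m is the indeterminate
   'X_(m-1); the alpha_m with m > n do not affect the coefficient of X^n in the
   exponential. *)
Definition generic_egf (n : nat) : fps {mpoly rat[n]} :=
  Fps (fun m => if m is i.+1 then
                  if insub i is Some j then ((i.+1)`!%:R : rat)^-1 *: 'X_j else 0
                else 0).

Definition betaQ (n : nat) : {mpoly rat[n]} :=
  (n`!%:R : rat) *: fps_exp (generic_egf n) n.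

Lemma betaQ_over n (N : semiringClosed rat) : betaQ n \is a mpolyOver n N.
Proof.
pose F := generic_egf n; rewrite /betaQ -/F.
have [S0 SD] := mpolyOver_addr_closed n N; have [S1 SM] := mpolyOver_mulr_closed n N.
pose b m := (m`!%:R : rat) *: fps_exp F m.
have F_nat i : (i`!%:R : rat) *: (F i.+1 *+ i.+1) \is a mpolyOver n N.
  rewrite /F /=; case: insub => [j|]; last by rewrite mul0rn scaler0.
  rewrite -scaler_nat !scalerA -natrM mulnC -factS mulfV.
    by rewrite scale1r; exact: mpolyOverX.
  by rewrite pnatr_eq0 -lt0n fact_gt0.
suff: forall m, b m \is a mpolyOver n N by exact.
elim/ltn_ind=> -[|m] IHm.
  by rewrite /b /= big_ord1 expr0 !fact0 invr1 !scale1r.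
rewrite /b factS mulnC natrM -scalerA [m.+1%:R *: _]scaler_nat fps_exp_rec // scaler_sumr.
apply: (big_ind (fun p => p \is a mpolyOver n N)) => // i _.
have le_im : (i <= m)%N by rewrite -ltnS.
rewrite -(bin_fact le_im) natrM -scalerA natrM -scalerA scalerAr scalerAl.
apply: mpolyOverZ; first exact: rpred_nat.
by apply: SM; rewrite // IHm // ltnS leq_subr.
Qed.

Lemma betaQ_nat n m : (betaQ n)@_m \is a Num.nat.
Proof.
by have /mpolyOverP := betaQ_over n (GRing.SemiringClosed.clone rat Num.nat_num_subdef _); apply.
Qed.

(* By betaQ_nat, the coefficients of betaQ n are nonnegative integers, so taking
   numerators loses nothing. *)
Definition beta (n : nat) : {mpoly int[n]} := map_mpoly numq (betaQ n).

Lemma map_beta n : map_mpoly intr (beta n) = betaQ n.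
Proof.
rewrite /beta {2}/map_mpoly /mmap raddf_sum [RHS]mpolyE /=; apply: eq_bigr => m _.
rewrite mmap1_id mul_mpolyC map_mpolyZ map_mpolyX /= numqK //.
exact/intr_nat/betaQ_nat.
Qed.

(* exp_!: the indeterminate 'X_i of beta n stands for alpha_(i+1), and beta 0 = 1.
   The constant term of A is ignored. *)
Definition exp_fact (K : comNzRingType) (A : fps K) : fps K :=
  Fps (fun n => (map_mpoly intr (beta n)).@[fun i => A i.+1]).

(* Main.v *)
Require Import Defs.
From HB Require Import structures.
From mathcomp Require Import all_boot all_order all_algebra.
From mathcomp Require Import boolp mpoly ring zify.

Set Implicit Arguments.
Unset Strict Implicit.
Unset Printing Implicit Defensive.

Import GRing.Theory Num.Theory.
Local Open Scope ring_scope.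

(* The Cartier operators L_r (r < p) are determined by A = \sum_r X^r (L_r A)^p.  By
   Christol's theorem, A is algebraic iff it lies in a finite set of series stable under
   the L_r; all the coefficients of such a set lie in a common finite field F.

   Let D be the shift A |-> \sum_n a_(n+1) X^n, which is a derivation of the shuffle
   product (the product of exponential generating series).  Then L_r = L_0 D^r, the map
   L_0 is a ring morphism for the shuffle product, and every p-th shuffle power is a
   constant.  Hence the shuffle subring generated by a finite L-stable set with
   coefficients in F is again finite and L-stable.

   (ii) -> (i): with B = exp_!(A) one has DB = DA * B and B^p = 1, so DA = DB * B^(p-1)
   lies in such a subring.
   (i) -> (ii): Bell's formula in characteristic p gives
   L_0 exp_!(W) = exp_!(L_0 W + w_1 X), and each L_r exp_!(W) is a multiple of it by an
   element of the subring generated by the L_j W.  So the products u * exp_!(W), with W in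
   a finite L-stable set containing A and u in the subring that it generates, form a finite
   L-stable set. *)

(** * The shuffle ring *)

(** A copy of [fps R], so that the same sequences can carry the shuffle product beside the Cauchy
    product; only the additive structure is shared. *)
Definition hurwitz (R : Type) := fps R.

HB.instance Definition _ (R : comNzRingType) :=
  GRing.Zmodule.copy (hurwitz R) (fps R).

Definition shift (R : Type) (A : fps R) : fps R := Fps (fun n => A n.+1).

Section HurwitzRing.
Variable R : comNzRingType.
Implicit Types A B C : hurwitz R.
Local Notation D := (@shift R : hurwitz R -> hurwitz R).

(* The recursion says that the shift is a derivation; see shuffleE for the usual formula
   with binomial coefficients. *)
Fixpoint shuffle_coef n A B : R :=
  if n is n'.+1 then shuffle_coef n' (D A) B + shuffle_coef n' A (D B)
  else A 0%N * B 0%N.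

Definition shuffle A B : hurwitz R := Fps (fun n => shuffle_coef n A B).

Let shuffleC : commutative shuffle.
Proof.
move=> A B; apply: fpsP => n /=; elim: n A B => [|n IH] A B /=; first exact: mulrC.
by rewrite IH addrC IH.
Qed.

Let shuffleDl : left_distributive shuffle +%R.
Proof.
move=> A B C; apply: fpsP => n.
have -> : (shuffle A C + shuffle B C) n = shuffle_coef n A C + shuffle_coef n B C by [].
rewrite /=; elim: n A B C => [|n IH] A B C /=; first exact: mulrDl.
by rewrite (IH (D A) (D B) C) (IH A B (D C)) addrACA.
Qed.

Let shuffleA : associative shuffle.
Proof.
have sDl n A B C : shuffle_coef n (A + B) C = shuffle_coef n A C + shuffle_coef n B C.
  by have := congr1 (fun E : fps R => E n) (shuffleDl A B C).
have sC n A B : shuffle_coef n A B = shuffle_coef n B A.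
  by have := congr1 (fun E : fps R => E n) (shuffleC A B).
move=> A B C; apply: fpsP => n /=; elim: n A B C => [|n IH] A B C /=; first exact: mulrA.
have -> E F : D (shuffle E F) = shuffle (D E) F + shuffle E (D F) by exact: fpsP.
have -> E F : D (shuffle E F) = shuffle (D E) F + shuffle E (D F) by exact: fpsP.
have sDr m E F G : shuffle_coef m E (F + G) = shuffle_coef m E F + shuffle_coef m E G.
  by rewrite !(sC m E) sDl.
by rewrite sDr sDl !IH addrA.
Qed.

Let const1 : hurwitz R := Fps (fun n => (n == 0%N)%:R).

Let shuffle1 : left_id const1 shuffle.
Proof.
have s0 n A : shuffle_coef n 0 A = 0.
  by elim: n A => [|n IH] A /=; [rewrite mul0r | rewrite [D 0](_ : _ = 0) ?IH ?addr0].
move=> A; apply: fpsP => n /=; elim: n A => [|n IH] A /=; first exact: mul1r.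
by rewrite [D const1](_ : _ = 0) ?s0 ?add0r ?IH.
Qed.

Let const1_neq0 : const1 != 0.
Proof. exact: (@oner_neq0 (fps R)). Qed.

HB.instance Definition _ :=
  GRing.Zmodule_isComNzRing.Build (hurwitz R) shuffleA shuffleC shuffle1 shuffleDl const1_neq0.

Lemma shiftD A B : D (A + B) = D A + D B. Proof. exact: fpsP. Qed.
Lemma shift_shuffle A B : D (A * B) = D A * B + A * D B. Proof. exact: fpsP. Qed.
Lemma shuffle0 A B : (A * B) 0%N = A 0%N * B 0%N. Proof. by []. Qed.

End HurwitzRing.

(** * Derivations in characteristic p *)

Lemma iter_derivM (R : comNzRingType) (D : R -> R)
    (DD : {morph D : x y / x + y}) (DM : forall x y, D (x * y) = D x * y + x * D y) n x y :
  iter n D (x * y) = \sum_(i < n.+1) (iter i D x * iter (n - i) D y) *+ 'C(n, i).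
Proof.
have D0 : D 0 = 0 by apply: (addrI (D 0)); rewrite -DD !addr0.
have Dn m z : D (z *+ m) = D z *+ m.
  by elim: m => [|m IH]; rewrite ?mulr0n // !mulrS DD IH.
elim: n => [|n IH]; first by rewrite big_ord1 /= mulr1n.
rewrite iterS {}IH (big_morph D DD D0).
under eq_bigr => i _ do rewrite Dn DM mulrnDl -!iterS -subSn -1?ltnS ?ltn_ord //.
rewrite big_split /= [RHS]big_ord_recl /= bin0 mulr1n.
rewrite [in RHS](eq_bigr (fun i : 'I_n.+1 =>
    iter i.+1 D x * iter (n - i) D y *+ 'C(n, i.+1) +
    iter i.+1 D x * iter (n - i) D y *+ 'C(n, i))); last first.
  by move=> i _; rewrite /bump /= add1n subSS binS mulrnDr.
rewrite big_split /= addrA addrC; congr (_ + _).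
rewrite big_ord_recl /= bin0 mulr1n; congr (_ + _).
rewrite [RHS]big_ord_recr /= bin_small // mulr0n addr0; apply: eq_bigr => i _.
by rewrite /bump /= add1n subSS.
Qed.

(** The binomial coefficients C(p, i) with 0 < i < p vanish in the Leibniz formula, so the p-th
    iterate of a derivation is again a derivation. *)
Lemma iter_pchar_derivM p (R : comNzRingType) (charR : p \in [pchar R]) (D : R -> R)
    (DD : {morph D : x y / x + y}) (DM : forall x y, D (x * y) = D x * y + x * D y) x y :
  iter p D (x * y) = iter p D x * y + x * iter p D y.
Proof.
have := prime_gt0 (pcharf_prime charR); rewrite iter_derivM //.
case: p charR => // m charR _.
rewrite big_ord_recr subnn binn mulr1n addrC; congr (_ + _).
rewrite big_ord_recl subn0 bin0 mulr1n big1 => [|i _]; first exact: addr0.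
by rewrite -mulr_natr bin_lt_pcharf_0 ?mulr0 //= /bump /= add1n ltnS ltn_ord.
Qed.

(* In characteristic p, Bell's formula for the p-th derivative of an exponential
   e^F is D^p e^F = (D^p F + (D F)^p) e^F; here f_i and b_i stand for D^i F and
   D^i e^F, and the term with f_p has been removed from the sum.  It is obtained by
   comparing the coefficients of X^(p-1) in the differential equation satisfied by
   the exponential of \sum_(0 < i < p) f_i X^i / i!, truncated so that only
   factorials prime to p occur. *)
Lemma bell_pchar p (R : comNzRingType) (charR : p \in [pchar R]) (g f b : nat -> R) :
    (forall k, (k < p)%N -> k`!%:R * g k = 1) ->
    (forall i, (i.+1 < p)%N -> b i.+1 = \sum_(j < i.+1) f j.+1 * b (i - j)%N *+ 'C(i, j)) ->
  \sum_(j < p.-1) f j.+1 * b (p.-1 - j)%N *+ 'C(p.-1, j) = f 1%N ^+ p * b 0%N.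
Proof.
move=> gK bS; have p_gt1 := prime_gt1 (pcharf_prime charR).
case: p p_gt1 charR gK bS => [|m] //= m_gt0 charR gK bS.
have g0 : g 0%N = 1 by rewrite -(gK 0%N) // mul1r.
have gS k : (k < m)%N -> g k.+1 *+ k.+1 = g k.
  move=> lt_km; have gSK := gK k.+1 lt_km; rewrite factS natrM in gSK.
  transitivity (k`!%:R * g k * (g k.+1 *+ k.+1)); first by rewrite gK ?mul1r 1?ltnW.
  transitivity (g k * (k.+1%:R * k`!%:R * g k.+1)); last by rewrite gSK mulr1.
  by rewrite -mulr_natr; ring.
(* Here p = m + 1 and [g k] plays the role of 1/k!, so [F] is the truncated sum of the f_i X^i / i!
   and [E] is its exponential cut after F^m. *)
pose G := \poly_(i < m) (f i.+1 * g i.+1); pose F : {poly R} := G * 'X.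
pose E : {poly R} := \sum_(k < m.+1) g k *: F ^+ k.
have F'E i : F^`()`_i = if (i < m)%N then f i.+1 * g i else 0.
  rewrite coef_deriv coefMX /= coef_poly; case: ifP => lt_im; last by rewrite mul0rn.
  by rewrite -mulrnAr gS.
(* The cut adds to E' = F' E a correction of order at least m, so the coefficients of [E] up to X^m
   still obey the recursion of an exponential. *)
have dE : E^`() = F^`() * E - g m *: (F^`() * F ^+ m).
  rewrite /E [in RHS]big_ord_recr /= mulrDr -scalerAr addrK.
  rewrite big_ord_recl expr0 derivD derivZ derivC scaler0 add0r.
  rewrite raddf_sum mulr_sumr; apply: eq_bigr => i _.
  by rewrite lift0 /= derivZ deriv_exp /= -scalerMnr scalerMnl gS // -scalerAr.
have F0 : F`_0 = 0 by rewrite coefMX.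
have E0 : E`_0 = 1.
  rewrite coef_sum big_ord_recl big1 ?addr0 => [|i _].
    by rewrite coefZ expr0 coef1 g0 mulr1.
  by rewrite lift0 exprS coefZ coef0M F0 mul0r mulr0.
have lowF n : (F^`() * F ^+ m)`_n = if (n < m)%N then 0 else (F^`() * G ^+ m)`_(n - m).
  by rewrite exprMn mulrA coefMXn.
have EK n : (n <= m)%N -> E`_n * b 0%N = g n * b n.
  elim/ltn_ind: n => -[|n] IH lt_nm; first by rewrite E0 g0.
  have dEn : E`_n.+1 *+ n.+1 * b 0%N = \sum_(j < n.+1) f j.+1 * g j * (g (n - j)%N * b (n - j)%N).
    rewrite -coef_deriv dE coefB coefZ lowF lt_nm mulr0 subr0 coefM mulr_suml.
    apply: eq_bigr => j _; have le_jn : (j <= n)%N by rewrite -ltnS.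
    rewrite F'E (leq_ltn_trans le_jn) //. rewrite -[_ * b 0%N]mulrA IH //.
      by rewrite ltnS leq_subr.
    exact: leq_trans (leq_subr _ _) (ltnW lt_nm).
  have bn : b n.+1 = n.+1`!%:R * (E`_n.+1 * b 0%N).
    rewrite factS mulnC natrM -mulrA [n.+1%:R * _]mulr_natl -mulrnAl dEn bS // mulr_sumr.
    apply: eq_bigr => j _; have le_jn : (j <= n)%N by rewrite -ltnS.
    have gj : j`!%:R * g j = 1 by apply: gK; rewrite ltnS (leq_trans le_jn) // ltnW.
    have gnj : (n - j)`!%:R * g (n - j)%N = 1.
      by apply: gK; rewrite ltnS (leq_trans (leq_subr _ _)) // ltnW.
    rewrite -(bin_fact le_jn) !natrM -mulr_natr.
    transitivity ('C(n, j)%:R * f j.+1 * b (n - j)%N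
      * (j`!%:R * g j) * ((n - j)`!%:R * g (n - j)%N)).
      by rewrite gj gnj; ring.
    ring.
  by rewrite bn mulrCA [RHS]mulrA gK ?mul1r.
have m_pos : (0 < m)%N by [].
have G0 : G`_0 = f 1%N.
  by rewrite coef_poly m_pos -[g 1%N]mulr1n gS // g0 mulr1.
(* The coefficient of X^m in E' is (m + 1) E_(m+1) = 0. So F' E agrees there with the correction g_m
   F' F^m, which contributes g_m f_1^p. *)
have dEm : (F^`() * E)`_m = g m * f 1%N ^+ m.+1.
  have := congr1 (fun P : {poly R} => P`_m) dE.
  rewrite coef_deriv mulrn_pchar // coefB coefZ lowF ltnn subnn coef0M F'E m_pos g0 mulr1.
  rewrite -[(G ^+ m)`_0]horner_coef0 horner_exp horner_coef0 G0 -exprS.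
  by move=> /esym/eqP; rewrite subr_eq0 => /eqP.
transitivity (m`!%:R * g m * f 1%N ^+ m.+1 * b 0%N); last by rewrite gK ?mul1r.
rewrite -[m`!%:R * _ * _]mulrA -dEm coefM big_ord_recr /= F'E ltnn mul0r addr0.
rewrite -mulrA mulr_suml mulr_sumr; apply: eq_bigr => j _.
have le_jm : (j <= m)%N by rewrite ltnW.
rewrite F'E ltn_ord -[_ * b 0%N]mulrA EK ?leq_subr // -(bin_fact le_jm) !natrM -mulr_natr.
have gj : j`!%:R * g j = 1 by apply: gK; rewrite ltnS.
have gmj : (m - j)`!%:R * g (m - j)%N = 1 by apply: gK; rewrite ltnS leq_subr.
transitivity ('C(m, j)%:R * f j.+1 * b (m - j)%N * (j`!%:R * g j) * ((m - j)`!%:R * g (m - j)%N)).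
  by rewrite gj gmj; ring.
ring.
Qed.

(** * Finite subrings *)

(** Finiteness as inclusion in a list: the list may have extra elements, so the notion passes to
    subsets at once. *)
Definition listable (T : eqType) (P : T -> Prop) : Prop :=
  exists s : seq T, forall x, P x -> x \in s.

Lemma listable_sub (T : eqType) (P Q : T -> Prop) :
  (forall x, P x -> Q x) -> listable Q -> listable P.
Proof. by move=> PQ [s sQ]; exists s => x /PQ /sQ. Qed.

(** Covers partial functions, such as the solution v of c v = y for c nonzero, which need not exist
    for every y. *)
Lemma listable_rel (T U : eqType) (P : T -> Prop) (E : T -> U -> Prop) :
    (forall x y y', E x y -> E x y' -> y = y') -> listable P ->
  listable (fun y => exists2 x, P x & E x y).
Proof.
move=> Efun [s sP].
pose h x := if pselect (exists y, E x y) is left ex then Some (sval (cid ex)) else None.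
exists (pmap h s) => y [x /sP x_s Exy]; rewrite mem_pmap; apply/mapP; exists x => //.
rewrite /h; case: pselect => [ex|[]]; last by exists y.
by congr Some; apply: Efun Exy (svalP (cid ex)).
Qed.

Lemma listable_image (T U : eqType) (P : T -> Prop) (h : T -> U) :
  listable P -> listable (fun y => exists2 x, P x & y = h x).
Proof. by move=> finP; apply: listable_rel finP => x y y' -> ->. Qed.

Lemma listable_image2 (T1 T2 U : eqType) (P : T1 -> Prop) (Q : T2 -> Prop)
    (h : T1 -> T2 -> U) :
  listable P -> listable Q ->
  listable (fun z => exists x y, [/\ P x, Q y & z = h x y]).
Proof.
move=> [s sP] [t tQ]; exists [seq h x y | x <- s, y <- t] => z [x [y [Px Qy ->]]].
by apply: allpairs_f; [apply: sP | apply: tQ].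
Qed.

Lemma listableU (T : eqType) (P Q : T -> Prop) :
  listable P -> listable Q -> listable (fun x => P x \/ Q x).
Proof.
move=> [s sP] [t tQ]; exists (s ++ t) => x PQx; rewrite mem_cat.
by case: PQx => [/sP -> //|/tQ ->]; rewrite orbT.
Qed.

Lemma listable_ffun (I : finType) (T : choiceType) (P : T -> Prop) :
  listable P -> listable (fun f : {ffun I -> T} => forall i, P (f i)).
Proof.
move=> [s sP]; exists [seq [ffun i => val (h i)] | h : {ffun I -> seq_sub s}] => f Pf.
apply/imageP; exists [ffun i => SeqSub (sP _ (Pf i))] => //.
by apply/ffunP => i; rewrite !ffunE.
Qed.

Definition subring (R : comNzRingType) (U : R -> Prop) : Prop :=
  [/\ U 1, forall x y, U x -> U y -> U (x - y) & forall x y, U x -> U y -> U (x * y)].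

Definition generated_subring (R : comNzRingType) (W : R -> Prop) (x : R) : Prop :=
  forall U, subring U -> (forall w, W w -> U w) -> U x.

Section Subring.
Variable R : comNzRingType.
Implicit Types (U W : R -> Prop) (x y : R).

Lemma subring0 U : subring U -> U 0.
Proof. by case=> U1 UB _; rewrite -(subrr 1); apply: UB. Qed.

Lemma subringD U x y : subring U -> U x -> U y -> U (x + y).
Proof.
move=> Usub Ux Uy; case: (Usub) => _ UB _; rewrite -[y]opprK.
by apply: (UB) => //; rewrite -sub0r; apply: UB => //; apply: subring0.
Qed.

Lemma subring_sum U (I : Type) (r : seq I) (P : pred I) (F : I -> R) :
  subring U -> (forall i, P i -> U (F i)) -> U (\sum_(i <- r | P i) F i).
Proof.
move=> Usub UF; apply: (big_ind U) => //; first exact: subring0.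
by move=> x y; apply: subringD.
Qed.

Lemma subringMn U x n : subring U -> U x -> U (x *+ n).
Proof.
move=> Usub Ux; elim: n => [|n IH]; first exact: subring0.
by rewrite mulrS; apply: subringD.
Qed.

Lemma subringX U x n : subring U -> U x -> U (x ^+ n).
Proof.
move=> [U1 _ UM] Ux; elim: n => [|n IH]; first by rewrite expr0.
by rewrite exprS; apply: UM.
Qed.

Lemma generated_subring_subring W : subring (generated_subring W).
Proof.
split=> [U [] //|x y Wx Wy U Usub WU|x y Wx Wy U Usub WU].
  by case: (Usub) => _ UB _; apply: UB; [apply: Wx | apply: Wy].
by case: (Usub) => _ _ UM; apply: UM; [apply: Wx | apply: Wy].
Qed.

Lemma generated_subring_incl W w : W w -> generated_subring W w.
Proof. by move=> Ww U _; apply. Qed.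

(** Since w^n lies in [U], powers of w reduce to exponents below n, and U[w] is covered by the
    finitely many n-tuples over [U]. *)
Lemma listable_adjoin U n w : (0 < n)%N -> subring U -> listable U -> U (w ^+ n) ->
  exists V, [/\ subring V, listable V, forall x, U x -> V x & V w].
Proof.
move=> n_gt0 Usub Ufin Uwn; case: (Usub) => U1 UB UM.
(* [V] is U[w] as values of polynomials, visibly a subring; [T] consists of the combinations of 1,
   ..., w^(n-1), visibly finite. Horner's scheme puts V inside T. *)
pose V x := exists2 g : {poly R}, (forall i, U g`_i) & x = g.[w].
pose T x := exists2 r : {ffun 'I_n -> R}, (forall i, U (r i)) & x = \sum_i r i * w ^+ i.
have TD x y : T x -> T y -> T (x + y).
  case=> [r Ur ->] [s Us ->]; exists [ffun i => r i + s i] => [i|].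
    by rewrite ffunE; apply: subringD.
  by rewrite -big_split; apply: eq_bigr => i _; rewrite ffunE mulrDl.
have TU i c : (i < n)%N -> U c -> T (c * w ^+ i).
  move=> lt_in Uc; exists [ffun j : 'I_n => if j == i :> nat then c else 0].
    by move=> j; rewrite ffunE; case: ifP => // _; apply: subring0.
  rewrite (bigD1 (Ordinal lt_in)) //= ffunE eqxx big1 ?addr0 // => j ne_ji.
  by rewrite ffunE ifN ?mul0r.
have T0 : T 0 by rewrite -(mul0r (w ^+ 0)); apply: TU n_gt0 _; apply: subring0.
have Tw x : T x -> T (x * w).
  case=> [r Ur ->]; rewrite mulr_suml; apply: (big_ind T) => // i _.
  rewrite -mulrA -exprSr; case: (ltngtP i.+1 n) (ltn_ord i) => // [lt_in _|-> _].
    exact: TU.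
  by rewrite -[_ * _]mulr1 -(expr0 w); apply: TU => //; apply: UM.
have VT x : V x -> T x.
  case=> g Ug ->; elim/poly_ind: g Ug => [|g c IH] Ug; first by rewrite horner0.
  rewrite hornerMXaddC; apply: TD.
    by apply/Tw/IH => i; move: (Ug i.+1); rewrite coefD coefMX coefC addr0.
  rewrite -[c]mulr1 -(expr0 w); apply: TU => //.
  by move: (Ug 0%N); rewrite coefD coefMX coefC add0r.
exists V; split.
- split=> [|x y [g Ug ->] [h Uh ->]|x y [g Ug ->] [h Uh ->]].
  + exists 1; rewrite ?hornerC // => i; rewrite coef1.
    by case: (i == 0)%N => //; apply: subring0.
  + by exists (g - h); rewrite ?hornerE // => i; rewrite coefB; apply: UB.
  + exists (g * h); rewrite ?hornerM // => i; rewrite coefM.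
    by apply: subring_sum => // j _; apply: UM.
- by apply: listable_sub VT _; apply/listable_image/listable_ffun.
- move=> x Ux; exists x%:P; rewrite ?hornerC // => i; rewrite coefC.
  by case: ifP => // _; apply: subring0.
- exists 'X; rewrite ?hornerX // => i; rewrite coefX.
  by case: (_ == _) => //; apply: subring0.
Qed.

Lemma listable_generated_subring U W n : (0 < n)%N -> subring U -> listable U ->
    listable W -> (forall w, W w -> U (w ^+ n)) ->
  listable (generated_subring W).
Proof.
move=> n_gt0 Usub Ufin [s sW] Wn.
suff [V [Vsub Vfin _ VW]] : exists V, [/\ subring V, listable V, forall x, U x -> V x &
    forall w, w \in s -> W w -> V w].
  apply: listable_sub Vfin => x; apply=> // w Ww; apply: VW => //; exact: sW.
elim: s {sW} => [|w s [V [Vsub Vfin UV VW]]]; first by exists U; split.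
(* The list may contain elements outside [W], for which no power is known to lie in [U]; they are
   skipped. *)
have [Ww|nWw] := pselect (W w); last first.
  by exists V; split=> // x; rewrite inE => /predU1P[->|/VW//].
have [V' [V'sub V'fin VV' V'w]] := listable_adjoin n_gt0 Vsub Vfin (UV _ (Wn _ Ww)).
exists V'; split=> // [x /UV/VV' //|x]; rewrite inE => /predU1P[-> //|xs Wx].
exact/VV'/VW.
Qed.

End Subring.

(** * Constants, p-th powers and linear equations in the shuffle ring *)

Definition hconst (R : comNzRingType) (c : R) : hurwitz R :=
  Fps (fun n => if n == 0%N then c else 0).

Section HurwitzTheory.
Variable R : comNzRingType.
Implicit Types A B : hurwitz R.
Local Notation D := (@shift R : hurwitz R -> hurwitz R).

Lemma hcoefB A B n : (A - B) n = A n - B n. Proof. by []. Qed.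

Lemma hconstB c d : hconst (c - d) = hconst c - hconst d :> hurwitz R.
Proof. by apply: fpsP => n; rewrite hcoefB /=; case: ifP; rewrite ?subr0. Qed.

Lemma hconst1 : hconst 1 = 1 :> hurwitz R.
Proof. by apply: fpsP => -[]. Qed.

Lemma shift_hconst c : D (hconst c) = 0. Proof. exact: fpsP. Qed.

Lemma hurwitz_shift_inj A B : A 0%N = B 0%N -> D A = D B -> A = B.
Proof.
move=> AB0 DAB; apply: fpsP => -[//|n].
exact: (congr1 (fun E : fps R => E n) DAB).
Qed.

Lemma hconstM c d : hconst (c * d) = hconst c * hconst d :> hurwitz R.
Proof.
apply: hurwitz_shift_inj; rewrite ?shuffle0 //.
by rewrite shift_shuffle !shift_hconst mul0r mulr0 addr0.
Qed.

Lemma hconst_natr n : hconst n%:R = n%:R :> hurwitz R.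
Proof.
elim: n => [|n IH]; first by apply: fpsP => -[].
rewrite -addn1 !natrD -IH -hconst1; apply: fpsP => i.
by rewrite fps_coefD /=; case: ifP => // _; rewrite addr0.
Qed.

Lemma iter_shift n A i : iter n D A i = A (n + i)%N.
Proof. by elim: n i => //= n IH i; rewrite IH addSnnS. Qed.

Lemma iter_shift_shuffle n A B :
  iter n D (A * B) = \sum_(i < n.+1) (iter i D A * iter (n - i) D B) *+ 'C(n, i).
Proof. by apply: iter_derivM; [exact: shiftD | exact: shift_shuffle]. Qed.

Lemma hcoef_sum (I : Type) (r : seq I) (P : pred I) (F : I -> hurwitz R) n :
  (\sum_(i <- r | P i) F i) n = \sum_(i <- r | P i) F i n.
Proof. by apply: (big_morph (fun E : hurwitz R => E n)). Qed.

Lemma hcoefMn A m n : (A *+ m) n = A n *+ m.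
Proof. by elim: m => // m IH; rewrite !mulrS -IH. Qed.

Lemma shuffleE A B n :
  (A * B) n = \sum_(i < n.+1) (A i * B (n - i)%N) *+ 'C(n, i).
Proof.
rewrite -[n in LHS]addn0 -iter_shift iter_shift_shuffle hcoef_sum.
by apply: eq_bigr => i _; rewrite hcoefMn shuffle0 !iter_shift !addn0.
Qed.

Lemma hurwitz_pchar p : p \in [pchar R] -> p \in [pchar hurwitz R].
Proof.
move=> charR; apply/andP; split; first exact: pcharf_prime charR.
by rewrite -hconst_natr pcharf0 //; apply/eqP/fpsP => -[].
Qed.

Lemma shift_expn A n : D (A ^+ n.+1) = A ^+ n * D A *+ n.+1.
Proof.
elim: n => [|n IH]; first by rewrite expr1 expr0 mul1r.
by rewrite exprS shift_shuffle IH mulrnAr mulrA -exprS [D A * _]mulrC -mulrS.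
Qed.

(** The derivative p A^(p-1) DA vanishes, and a series killed by the shift is its constant term. *)
Lemma hurwitz_expp p A : p \in [pchar R] -> A ^+ p = hconst (A 0%N ^+ p).
Proof.
move=> charR; have := prime_gt0 (pcharf_prime charR).
case: p charR => // m charR _; apply: hurwitz_shift_inj => /=.
  by elim: m.+1 => // n IH; rewrite !exprS shuffle0 IH.
by rewrite shift_expn shift_hconst (mulrn_pchar (hurwitz_pchar charR)).
Qed.

(** The shift involves no division, so this linear equation determines the coefficients one after
    the other in every characteristic. *)
Lemma exponential_uniq (F E E' : hurwitz R) :
  E 0%N = E' 0%N -> D E = F * E -> D E' = F * E' -> E = E'.
Proof.
move=> E0 DE DE'; apply: fpsP; elim/ltn_ind=> -[//|n] IH.
have -> : E n.+1 = D E n by []. have -> : E' n.+1 = D E' n by [].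
rewrite DE DE' !shuffleE; apply: eq_bigr => i _; congr (_ * _ *+ _).
by apply: IH; rewrite ltnS leq_subr.
Qed.

End HurwitzTheory.

(** * Cartier operators *)

(* 0 if c has no p-th root, which never happens in the perfect fields considered below. *)
Definition pth_root (K : fieldType) (p : nat) (c : K) : K :=
  if pselect (exists b, b ^+ p = c) is left ex then sval (cid ex) else 0.

Definition cartier (K : fieldType) (p r : nat) (A : fps K) : fps K :=
  Fps (fun n => pth_root p (A (p * n + r)%N)).

Definition perfect_exponent (K : fieldType) (p : nat) : Prop :=
  p \in [pchar K] /\ forall c : K, exists b, b ^+ p = c.

Lemma pchar_nat_exp (R : comNzRingType) p e : p \in [pchar R] -> [pchar R].-nat (p ^ e)%N.
Proof.
by move=> charR; rewrite pnatX pnatE ?(pcharf_prime charR) // charR.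
Qed.

Section Cartier.
Variables (K : fieldType) (p : nat).
Hypothesis perfK : perfect_exponent K p.
Let charK : p \in [pchar K]. Proof. by case: perfK. Qed.
Let p_prime : prime p. Proof. exact: pcharf_prime charK. Qed.
Let p_gt0 : (0 < p)%N. Proof. exact: prime_gt0. Qed.

Local Notation root := (@pth_root K p).
Local Notation L := (@cartier K p).

Lemma pth_rootK c : root c ^+ p = c.
Proof.
rewrite /pth_root; case: pselect => [ex|[]]; first exact: svalP (cid ex).
by case: perfK.
Qed.

Lemma expp_inj : injective (fun c : K => c ^+ p).
Proof. by move=> c d; apply: (fmorph_inj (pFrobenius_aut charK)). Qed.

Lemma pth_root_expp c : root (c ^+ p) = c.
Proof. by apply: expp_inj; rewrite /= pth_rootK. Qed.

Lemma expp0 : 0 ^+ p = 0 :> K. Proof. by rewrite expr0n gtn_eqF. Qed.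

Lemma pth_rootD c d : root (c + d) = root c + root d.
Proof.
apply: expp_inj => /=.
by rewrite (exprDn_pchar _ _ (pchar_nat_exp 1 charK)) !pth_rootK.
Qed.

Lemma pth_rootM c d : root (c * d) = root c * root d.
Proof. by apply: expp_inj; rewrite /= exprMn !pth_rootK. Qed.

Lemma pth_root0 : root 0 = 0. Proof. by rewrite -{1}expp0 pth_root_expp. Qed.
Lemma pth_root1 : root 1 = 1. Proof. by rewrite -{1}(expr1n _ p) pth_root_expp. Qed.

Lemma pth_rootN c : root (- c) = - root c.
Proof. by apply: (addIr (root c)); rewrite -pth_rootD !addNr pth_root0. Qed.

Lemma cartierD r (A B : fps K) : L r (A + B) = L r A + L r B.
Proof. by apply: fpsP => n; rewrite /= pth_rootD. Qed.

Lemma cartierN r (A : fps K) : L r (- A) = - L r A.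
Proof. by apply: fpsP => n; rewrite /= pth_rootN. Qed.

Lemma cartierMn r (A : fps K) m : L r (A *+ m) = L r A *+ m.
Proof.
elim: m => [|m IH]; first by apply: fpsP => n; rewrite /= pth_root0.
by rewrite !mulrS cartierD IH.
Qed.

Lemma cartier_sum r (I : Type) (s : seq I) (P : pred I) (F : I -> fps K) :
  L r (\sum_(i <- s | P i) F i) = \sum_(i <- s | P i) L r (F i).
Proof.
apply: (big_morph (L r)); first exact: cartierD.
by rewrite -(mulr0n 0) cartierMn.
Qed.

Lemma cartier_shift r (A : fps K) : L r (shift A) = L r.+1 A.
Proof. by apply: fpsP => n; rewrite /= addnS. Qed.

Lemma cartier_iter_shift r (A : hurwitz K) : L r A = L 0 (iter r (@shift K) A).
Proof. by apply: fpsP => n; rewrite /= iter_shift addn0 addnC. Qed.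

Lemma shift_cartier r (A : fps K) : shift (L r A) = L r (iter p (@shift K) A).
Proof. by apply: fpsP => n; rewrite /= iter_shift mulnS addnA. Qed.

Lemma cartier_p (A : fps K) : L p A = shift (L 0 A).
Proof. by apply: fpsP => n; rewrite /= addn0 mulnS addnC. Qed.

Lemma hcartierD r (A B : hurwitz K) : L r (A + B) = (L r A : hurwitz K) + L r B.
Proof. exact: cartierD. Qed.

(** Shifting after L_0 amounts to applying D^p before it, and D^p is a derivation in characteristic
    p. Both sides thus obey the same Leibniz recursion on coefficients. *)
Lemma cartier0_shuffle (A B : hurwitz K) : L 0 (A * B) = (L 0 A : hurwitz K) * L 0 B.
Proof.
apply: fpsP => n; elim: n A B => [|n IH] A B.
  by rewrite shuffle0 /= muln0 pth_rootM.
transitivity (shift (L 0 (A * B)) n) => //.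
rewrite shift_cartier (iter_pchar_derivM (hurwitz_pchar charK)); last 2 first.
- exact: shiftD.
- exact: shift_shuffle.
by rewrite hcartierD fps_coefD !IH -!shift_cartier.
Qed.

Lemma cartier_shuffle r (A B : hurwitz K) :
  L r (A * B) = \sum_(j < r.+1) ((L j A : hurwitz K) * L (r - j) B) *+ 'C(r, j).
Proof.
rewrite cartier_iter_shift iter_shift_shuffle (@cartier_sum 0).
apply: eq_bigr => j _; rewrite (@cartierMn 0); congr (_ *+ _).
by rewrite cartier0_shuffle -!cartier_iter_shift.
Qed.

Lemma cartier_hconst r c : L r (hconst c) = if r == 0%N then hconst (root c) else 0.
Proof.
apply: fpsP => n /=; rewrite addn_eq0 muln_eq0 gtn_eqF //=.
by case: r n => [|r] [|n]; rewrite /= ?pth_root0.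
Qed.

End Cartier.

(** * The exponential *)

(** The recursion is E' = F' E written for the coefficients of exponential series, so it makes sense
    over any ring. It calls all earlier values, whence the fuel; fuel at least n gives the right
    value. *)
Fixpoint hexp_rec (R : comNzRingType) (a : nat -> R) (fuel n : nat) : R :=
  if fuel is fuel'.+1 then
    if n is n'.+1 then
      \sum_(i < n'.+1) a i.+1 * hexp_rec a fuel' (n' - i) *+ 'C(n', i)
    else 1
  else 1.

Definition hexp (R : comNzRingType) (a : nat -> R) : hurwitz R :=
  Fps (fun n => hexp_rec a n n).

Section Hexp.
Variable R : comNzRingType.
Implicit Type a : nat -> R.

Lemma hexp_recE a fuel n : (n <= fuel)%N -> hexp_rec a fuel n = hexp a n.
Proof.
rewrite /=; elim/ltn_ind: n fuel => -[|n] IH [|fuel] //= le_nf.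
apply: eq_bigr => i _; congr (_ * _ *+ _).
by rewrite !IH ?ltnS ?leq_subr // (leq_trans (leq_subr _ _)).
Qed.

Lemma hexp0 a : hexp a 0%N = 1. Proof. by []. Qed.

Lemma hexpS a n : hexp a n.+1 = \sum_(i < n.+1) a i.+1 * hexp a (n - i)%N *+ 'C(n, i).
Proof. by rewrite /=; apply: eq_bigr => i _; rewrite hexp_recE ?leq_subr. Qed.

Lemma hexp_unique a (b : nat -> R) n : b 0%N = 1 ->
    (forall m, (m < n)%N -> b m.+1 = \sum_(i < m.+1) a i.+1 * b (m - i)%N *+ 'C(m, i)) ->
  b n = hexp a n.
Proof.
move=> b0 bS; suff bE m : (m <= n)%N -> b m = hexp a m by exact: bE.
elim/ltn_ind: m => -[//|m] IH lt_mn; rewrite bS // hexpS.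
apply: eq_bigr => i _; rewrite IH ?ltnS ?leq_subr //.
by rewrite (leq_trans (leq_subr _ _)) // ltnW.
Qed.

Lemma shift_hexp (A : hurwitz R) :
  shift (hexp A) = (shift A : hurwitz R) * hexp A.
Proof.
by apply: fpsP => n; rewrite shuffleE -hexpS.
Qed.

End Hexp.

(** Universality of the recursion: the n-th value is a polynomial expression in a_1, ..., a_n
    alone. *)
Lemma rmorph_hexp (R S : comNzRingType) (f : {rmorphism R -> S}) (a : nat -> R) (b : nat -> S) n :
  (forall i, (i < n)%N -> f (a i.+1) = b i.+1) -> f (hexp a n) = hexp b n.
Proof.
move=> fab; apply: (@hexp_unique S b (fun m => f (hexp a m))) => [|m lt_mn].
  by rewrite hexp0 rmorph1.
rewrite hexpS rmorph_sum; apply: eq_bigr => i _; rewrite rmorphMn rmorphM fab //.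
by rewrite (leq_trans _ lt_mn).
Qed.

(** The generic sequence of arguments, with alpha_(k+1) represented by the indeterminate ['X_k]; it
    is 0 from alpha_(N+1) on. *)
Definition mpoly_var (R : nzRingType) (N i : nat) : {mpoly R[N]} :=
  if i is j.+1 then if insub j is Some k then 'X_k else 0 else 0.

(** Over [rat], multiplying the recursion of the exponential series by factorials gives that of
    [hexp]; the result descends to [int] because [intr] is injective. *)
Lemma beta_hexp n : beta n = hexp (mpoly_var int n) n.
Proof.
have betaQE : betaQ n = hexp (mpoly_var rat n) n.
  apply: (@hexp_unique _ _ (fun m => (m`!%:R : rat) *: fps_exp (generic_egf n) m)).
    by rewrite /= big_ord1 expr0 !fact0 invr1 !scale1r.
  move=> m _; rewrite factS mulnC natrM -scalerA [m.+1%:R *: _]scaler_nat fps_exp_rec //.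
  rewrite scaler_sumr; apply: eq_bigr => i _; have le_im : (i <= m)%N by rewrite -ltnS.
  have -> : mpoly_var rat n i.+1 = (i.+1)`!%:R *: generic_egf n i.+1.
    rewrite /=; case: insub => [j|]; last by rewrite scaler0.
    by rewrite scalerA mulfV ?scale1r // pnatr_eq0 -lt0n fact_gt0.
  rewrite -(bin_fact le_im) -scalerAr -scalerAl -[RHS]scaler_nat !scalerA.
  rewrite -[_ *+ i.+1]scaler_nat -scalerAl !scalerA factS -!natrM.
  by congr (_%:R *: _); lia.
apply/mpolyP => m; apply: (@intr_inj rat).
have intr_coef (q : {mpoly int[n]}) : (q@_m)%:~R = (map_mpoly intr q)@_m :> rat.
  by rewrite mcoeff_map_mpoly.
rewrite !intr_coef map_beta betaQE; congr (_ @_ m); apply/esym.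
apply: (@rmorph_hexp _ _ (map_mpoly intr)) => i _ /=.
by case: insub => [j|]; rewrite ?map_mpolyX ?rmorph0.
Qed.

(** The generic [hexp] over the integers is carried first to polynomials over K, then evaluated at
    the coefficients of A. *)
Lemma exp_factE (K : comNzRingType) (A : fps K) : exp_fact A = hexp A.
Proof.
apply: fpsP => n; rewrite /exp_fact /fps_coef -/(fps_coef _) beta_hexp.
have /= -> := @rmorph_hexp _ _ (map_mpoly intr) (mpoly_var int n) (mpoly_var K n) n.
  apply: (@rmorph_hexp _ _ (meval _)) => i lt_in /=.
  by rewrite insubT mevalXU.
by move=> i _ /=; case: insub => [j|]; rewrite ?map_mpolyX ?rmorph0.
Qed.

(** * Series with finitely many iterated Cartier images *)

(** [P] may be any finite stable set around the orbit of A, which leaves room for convenient larger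
    sets. *)
Definition automatic (K : fieldType) (p : nat) (A : fps K) : Prop :=
  exists P : fps K -> Prop, [/\ listable P, P A &
    forall r v, (r < p)%N -> P v -> P (cartier p r v)].

(** Every element lies in some finite field with p^e elements, as in a subfield of an algebraic
    closure of F_p. *)
Definition frob_periodic (K : fieldType) (p : nat) : Prop :=
  forall c : K, exists2 e, (0 < e)%N & c ^+ (p ^ e) = c.

(** A list of distinct roots has bounded length; one of maximal length contains every root, since
    otherwise it could be extended. *)
Lemma listable_roots (K : fieldType) (f : {poly K}) : f != 0 -> listable (fun x => root f x).
Proof.
move=> f0; pose S k := `[< exists s : seq K, [/\ uniq s, all (root f) s & size s = k] >].
have exS : exists k, S k by exists 0%N; apply/asboolP; exists [::].
have Sle k : S k -> (k <= size f)%N.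
  by case/asboolP => s [us rs <-]; rewrite ltnW // max_poly_roots.
case: (ex_maxnP exS Sle) => k /asboolP[s [us rs <-]] smax.
exists s => x fx; apply: contraT => xs.
have /smax : S (size (x :: s)).
  by apply/asboolP; exists (x :: s); rewrite /= xs us fx rs.
by rewrite /= ltnn.
Qed.

Section Automatic.
Variables (K : fieldType) (p : nat).
Hypotheses (charK : p \in [pchar K]) (perK : frob_periodic K p).
Let p_prime : prime p. Proof. exact: pcharf_prime charK. Qed.
Let p_gt0 : (0 < p)%N. Proof. exact: prime_gt0. Qed.

Lemma frob_periodic_perfect : perfect_exponent K p.
Proof.
split=> // c; have [[//|e] _ ce] := perK c.
by exists (c ^+ (p ^ e)); rewrite -exprM -expnSr.
Qed.
Let perfK := frob_periodic_perfect.

Local Notation L := (@cartier K p).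

(** The elements of K that belong to the finite field with p^e elements. *)
Definition frob_fixed (e : nat) (c : K) : Prop := c ^+ (p ^ e) = c.

Lemma frob_fixed_subring e : subring (frob_fixed e).
Proof.
have pe := pchar_nat_exp e charK.
split=> [|x y xe ye|x y xe ye]; rewrite /frob_fixed ?expr1n //.
  rewrite exprDn_pchar // xe; congr (_ + _); apply: (addIr (y ^+ (p ^ e))).
  by rewrite -exprDn_pchar // ye !addNr expr0n expn_eq0 gtn_eqF.
by rewrite exprMn xe ye.
Qed.

Lemma listable_frob_fixed e : (0 < e)%N -> listable (frob_fixed e).
Proof.
move=> e_gt0; have q_gt1 : (1 < p ^ e)%N.
  by rewrite -(exp1n e) ltn_exp2r // prime_gt1.
apply: (@listable_sub _ _ (fun x => root ('X^(p ^ e) - 'X) x)).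
  by move=> c ce; rewrite rootE !hornerE ce subrr.
apply: listable_roots; rewrite -size_poly_gt0 size_polyDl ?size_polyXn //.
by rewrite size_polyN size_polyX.
Qed.

Lemma frob_fixed_mul e k c : frob_fixed e c -> frob_fixed (e * k) c.
Proof.
move=> ce; rewrite /frob_fixed expnM; elim: k => [|k IH]; first by rewrite expn0 expr1.
by rewrite expnSr exprM IH.
Qed.

Lemma frob_fixed_seq (s : seq K) :
  exists2 e, (0 < e)%N & forall c, c \in s -> frob_fixed e c.
Proof.
elim: s => [|c s [e e_gt0 se]]; first by exists 1%N.
have [e' e'_gt0 ce'] := perK c; exists (e * e')%N; first by rewrite muln_gt0 e_gt0.
move=> d; rewrite inE => /predU1P[->|/se]; last exact: frob_fixed_mul.
by rewrite mulnC; apply: frob_fixed_mul.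
Qed.

Lemma frob_fixed_exp e c n : frob_fixed e c -> frob_fixed e (c ^+ n).
Proof. by move=> ce; rewrite /frob_fixed exprAC ce. Qed.

Lemma frob_fixed_root e c : frob_fixed e c -> frob_fixed e (pth_root p c).
Proof.
by move=> ce; apply: (expp_inj perfK); rewrite /= exprAC (pth_rootK perfK).
Qed.

(** The coefficient v_n is the p-th power of the coefficient of index n / p of L_(n mod p) v.
    Descent on n leads to the finitely many constant terms of members of [P], which share one finite
    field. *)
Lemma cartier_closed_coef (P : fps K -> Prop) : listable P ->
    (forall r v, (r < p)%N -> P v -> P (L r v)) ->
  exists2 e, (0 < e)%N & forall v n, P v -> frob_fixed e (v n).
Proof.
move=> [s sP] PL; have [e e_gt0 se] := frob_fixed_seq [seq (v : fps K) 0%N | v <- s].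
exists e => // v n; elim/ltn_ind: n v => -[|n] IH v Pv.
  by apply: se; apply/mapP; exists v => //; apply: sP.
have lt_mod : (n.+1 %% p < p)%N by rewrite ltn_mod.
have := IH (n.+1 %/ p)%N _ _ (PL _ _ lt_mod Pv).
rewrite /= mulnC -divn_eq ltn_Pdiv ?prime_gt1 // => /(_ isT) /(@frob_fixed_exp _ _ p).
by rewrite (pth_rootK perfK).
Qed.

Lemma generated_subring_cartier (W : hurwitz K -> Prop) :
    (forall r v, (r < p)%N -> W v -> W (L r v)) ->
  forall r v, (r < p)%N -> generated_subring W v -> generated_subring W (L r v).
Proof.
move=> WL r v lt_rp Wv; have Gsub := generated_subring_subring W.
have [G1 GB GM] := Gsub.
(* All the L_s are treated at once, because L_r of a product involves every L_j with j at most r. *)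
pose U x := generated_subring W x /\ forall s, (s < p)%N -> generated_subring W (L s x).
suff Usub : subring U.
  have [] // : U v; last by move=> _; apply.
  apply: Wv => // w Ww; split=> [|s lt_sp]; first exact: generated_subring_incl.
  exact: generated_subring_incl (WL _ _ lt_sp Ww).
split=> [|x y [Gx Lx] [Gy Ly]|x y [Gx Lx] [Gy Ly]].
- split=> // s _; rewrite -hconst1 (cartier_hconst perfK); case: ifP => _.
    by rewrite (pth_root1 perfK) hconst1.
  exact: subring0.
- split=> [|s lt_sp]; first exact: GB.
  by rewrite (@cartierD _ _ perfK) (cartierN perfK); apply: GB; [apply: Lx | apply: Ly].
- split=> [|s lt_sp]; first exact: GM.
  rewrite (cartier_shuffle perfK); apply: (@subring_sum _ _ _ _ _ _ Gsub) => j _.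
  apply: (@subringMn _ _ _ _ Gsub).
  apply: GM; [apply: Lx | apply: Ly]; last exact: leq_ltn_trans (leq_subr _ _) lt_sp.
  by rewrite (leq_ltn_trans _ lt_sp) // -ltnS.
Qed.

(** The p-th shuffle power of w is the constant w_0^p, so [W] is adjoined to the finite ring of
    constants fixed by the e-th Frobenius power. *)
Lemma listable_generated e (W : hurwitz K -> Prop) : (0 < e)%N -> listable W ->
  (forall w, W w -> frob_fixed e (w 0%N)) -> listable (generated_subring W).
Proof.
move=> e_gt0 Wfin We; have [F1 FB FM] := frob_fixed_subring e.
apply: (@listable_generated_subring _ (fun v => exists2 c, frob_fixed e c & v = hconst c)
  W p) => //.
- split=> [|x y [c ce ->] [d de ->]|x y [c ce ->] [d de ->]].
  + by exists 1; rewrite ?hconst1.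
  + by exists (c - d); rewrite ?hconstB //; apply: FB.
  + by exists (c * d); rewrite ?hconstM //; apply: FM.
- exact/listable_image/listable_frob_fixed.
- move=> w /We we; exists (w 0%N ^+ p); first exact: frob_fixed_exp.
  exact: hurwitz_expp.
Qed.

End Automatic.

(** * Automaticity under the exponential and its inverse *)

Definition fps_monom1 (R : comNzRingType) (c : R) : hurwitz R :=
  Fps (fun n => if n == 1%N then c else 0).

Definition fps_mulX (R : comNzRingType) (A : fps R) : fps R :=
  Fps (fun n => if n is m.+1 then A m else 0).

Section AutomaticExp.
Variables (K : fieldType) (p : nat).
Hypotheses (charK : p \in [pchar K]) (perK : frob_periodic K p).
Let p_prime : prime p. Proof. exact: pcharf_prime charK. Qed.
Let p_gt0 : (0 < p)%N. Proof. exact: prime_gt0. Qed.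
Let p_gt1 : (1 < p)%N. Proof. exact: prime_gt1. Qed.
Let perfK := frob_periodic_perfect charK perK.
Local Notation L := (@cartier K p : nat -> hurwitz K -> hurwitz K).
Local Notation D := (@shift K : hurwitz K -> hurwitz K).
Implicit Types (A B w : hurwitz K).

Lemma cartier_hexpS w i :
  L i.+1 (hexp w) = \sum_(j < i.+1) L j.+1 w * L (i - j)%N (hexp w) *+ 'C(i, j).
Proof.
rewrite -cartier_shift shift_hexp (cartier_shuffle perfK).
by apply: eq_bigr => j _; rewrite cartier_shift.
Qed.

(** One has D L_0 = L_p, and Bell's formula turns L_p e^w into (L_p w + (L_1 w)^p) L_0 e^w. Here L_p
    w = D L_0 w, and (L_1 w)^p is the constant w_1, so both sides solve the same linear equation. *)
Lemma cartier0_hexp w : L 0 (hexp w) = hexp (L 0 w + fps_monom1 (w 1%N)).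
Proof.
have charH := hurwitz_pchar charK.
apply: (@exponential_uniq _ (D (L 0 w) + hconst (w 1%N))); last 2 first.
- have := @bell_pchar p _ charH (fun k => hconst (k`!%:R^-1)) (fun j => L j w)
    (fun j => L j (hexp w)).
  have -> : D (L 0 (hexp w)) = L p.-1.+1 (hexp w) by rewrite prednK // cartier_p.
  rewrite cartier_hexpS big_ord_recr /= subnn binn mulr1n prednK // cartier_p => ->.
  + rewrite (hurwitz_expp _ charK) -mulrDl addrC /= muln0 (pth_rootK perfK).
    by rewrite mulrDl.
  + move=> k lt_kp; rewrite -hconst_natr -hconstM mulfV ?hconst1 //.
    rewrite -(dvdn_pcharf charK); elim: k lt_kp => [|k IH] lt_kp.
      by rewrite dvdn1 gtn_eqF.
    by rewrite factS Euclid_dvdM // negb_or gtnNdvd // IH // ltnW.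
  + by move=> i _; rewrite cartier_hexpS.
- rewrite shift_hexp shiftD; congr ((_ + _) * _).
rewrite hexp0 -[RHS](pth_root1 perfK) -[in RHS](hexp0 w).
by rewrite /L /cartier /fps_coef muln0.
Qed.

Lemma cartier_hexp (W : hurwitz K -> Prop) w r :
    (forall r v, (r < p)%N -> W v -> W (L r v)) -> W w -> (r < p)%N ->
  exists2 u, generated_subring W u & L r (hexp w) = u * L 0 (hexp w).
Proof.
move=> WL Ww; have Gsub := generated_subring_subring W; have [G1 GB GM] := Gsub.
elim/ltn_ind: r => -[|r] IH lt_rp; first by exists 1; rewrite ?mul1r.
rewrite cartier_hexpS.
apply: (big_ind (fun v => exists2 u, generated_subring W u & v = u * L 0 (hexp w))).
- by exists 0; rewrite ?mul0r //; exact: (subring0 Gsub).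
- move=> _ _ [u Gu ->] [v Gv ->]; exists (u + v); rewrite ?mulrDl //.
  exact: (subringD Gsub).
- move=> i _; have le_ir : (i <= r)%N by rewrite -ltnS.
  have lt_rir : (r - i < r.+1)%N by rewrite ltnS leq_subr.
  have [//||u Gu ->] := IH (r - i)%N; first exact: ltn_trans lt_rp.
  exists (L i.+1 w * u *+ 'C(r, i)); last by rewrite mulrA mulrnAl.
  apply: (@subringMn _ _ _ _ Gsub); apply: GM Gu.
  exact: generated_subring_incl (WL _ _ (leq_ltn_trans (ltn_ord i) lt_rp) Ww).
Qed.

Lemma cartier_monom1 r c : (r < p)%N ->
  L r (fps_monom1 c) = if r == 1%N then hconst (pth_root p c) else 0.
Proof.
move=> lt_rp; apply: fpsP => n /=.
case: n => [|n].
  by rewrite muln0 add0n; case: ifP => //; rewrite (pth_root0 perfK).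
rewrite gtn_eqF ?(pth_root0 perfK); first by case: ifP.
by rewrite (leq_trans p_gt1) // mulnS -addnA leq_addr.
Qed.

Lemma automatic_hexp A : automatic p A -> automatic p (hexp A).
Proof.
case=> P [Pfin PA PL]; have [e e_gt0 Pe] := cartier_closed_coef charK perK Pfin PL.
have Fsub := frob_fixed_subring charK e; have [F1 FB FM] := Fsub.
have Ffin := listable_frob_fixed charK e_gt0.
have F0 : frob_fixed p e (0 : K) := subring0 Fsub.
(* The terms b X absorb the w_1 X produced by L_0 on exponentials; the constants a are needed
   because L_1 (b X) is a constant. This makes [W] stable both under the L_r and under w -> L_0 w +
   w_1 X. *)
pose W (w : hurwitz K) := exists v c, [/\ P v, exists a b,
  [/\ frob_fixed p e a, frob_fixed p e b & c = hconst a + fps_monom1 b] & w = (v : hurwitz K) + c].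
have Wfin : listable W by apply: listable_image2 => //; apply: listable_image2.
have WL r w : (r < p)%N -> W w -> W (L r w).
  move=> lt_rp [v [_ [Pv [a [b [Fa Fb ->]]] ->]]].
  exists (L r v), (L r (hconst a + fps_monom1 b)); split; [exact: PL | | exact: hcartierD].
  rewrite (hcartierD perfK) (cartier_hconst perfK) cartier_monom1 //.
  have [-> | r0] := eqVneq r 0%N.
    exists (pth_root p a), 0; split=> //; first exact: frob_fixed_root.
    by congr (_ + _); apply: fpsP => -[|[]].
  exists (if r == 1%N then pth_root p b else 0), 0; split=> //.
    by case: ifP => // _; apply: frob_fixed_root.
  by rewrite addrC; case: ifP => _; congr (_ + _); apply: fpsP => -[|[]].
have W0 w : W w -> W (L 0 w + fps_monom1 (w 1%N)).
  move=> Ww; have Fw : frob_fixed p e (w 1%N).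
    by case: Ww => v [_ [Pv [a [b [Fa Fb ->]]] ->]] /=; rewrite add0r; apply: (subringD Fsub); first exact: Pe.
  have [v [_ [Pv [a [b [Fa Fb ->]]] ->]]] := WL 0%N w p_gt0 Ww.
  exists v, (hconst a + fps_monom1 (b + w 1%N)); split=> //.
    by exists a, (b + w 1%N); split=> //; exact: (subringD Fsub).
  rewrite -!addrA; congr (_ + (_ + _)); apply: fpsP => n.
  by rewrite fps_coefD /=; case: ifP; rewrite ?addr0.
have Wcoef w : W w -> frob_fixed p e (w 0%N).
  by case=> v [_ [Pv [a [b [Fa Fb ->]]] ->]] /=; rewrite addr0; apply: (subringD Fsub); first exact: Pe.
have Gsub := generated_subring_subring W; have [G1 GB GM] := Gsub.
have Gfin := listable_generated charK e_gt0 Wfin Wcoef.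
have GL := generated_subring_cartier charK perK WL.
exists (fun E : hurwitz K => exists u w, [/\ generated_subring W u, W w & E = u * hexp w]).
split; first exact: (listable_image2 (fun u w : hurwitz K => u * hexp w)).
- exists 1, A; split; rewrite ?mul1r //.
  exists A, 0; split=> //; last by rewrite addr0.
  by exists 0, 0; split=> //; apply: fpsP => -[|[]] /=; rewrite ?addr0.
- move=> r _ lt_rp [u [w [Gu Ww ->]]].
  rewrite (cartier_shuffle perfK).
  (* Each L_(r-j) e^w is a multiple of L_0 e^w, so all terms of the sum share the single exponential
     of [w']. *)
  set w' := L 0 w + fps_monom1 (w 1%N).
  have [u' Gu' ->] : exists2 u', generated_subring W u' &
    \sum_(j < r.+1) L j u * L (r - j)%N (hexp w) *+ 'C(r, j) = u' * hexp w'.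
    apply: (big_ind (fun v => exists2 u', generated_subring W u' & v = u' * hexp w')).
    + by exists 0; rewrite ?mul0r //; exact: (subring0 Gsub).
    + move=> _ _ [x Gx ->] [y Gy ->]; exists (x + y); rewrite ?mulrDl //.
      exact: (subringD Gsub).
    + move=> j _; have le_jr : (j <= r)%N by rewrite -ltnS.
      have lt_rj : (r - j < p)%N := leq_ltn_trans (leq_subr _ _) lt_rp.
      have [x Gx ->] := cartier_hexp WL Ww lt_rj.
      exists (L j u * x *+ 'C(r, j)); last by rewrite cartier0_hexp mulrA mulrnAl.
      apply: (@subringMn _ _ _ _ Gsub); apply: GM Gx.
      exact: GL (leq_ltn_trans le_jr lt_rp) Gu.
  by exists u', w'; split=> //; apply: W0.
Qed.

Lemma automatic_hexp_inv A : A 0%N = 0 -> automatic p (hexp A) -> automatic p A.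
Proof.
move=> A0 [P [Pfin PB PL]]; have [e e_gt0 Pe] := cartier_closed_coef charK perK Pfin PL.
(* Shifts are included because DA is obtained from D e^A; stability persists since L_(p-1) D = L_p =
   D L_0. *)
pose W (w : hurwitz K) := P w \/ exists2 v, P v & w = shift v.
have Wfin : listable W by apply: listableU => //; apply: listable_image.
have WL r w : (r < p)%N -> W w -> W (L r w).
  move=> lt_rp [Pw|[v Pv ->]]; first by left; apply: PL.
  rewrite cartier_shift; have [lt_r1p|le_pr] := ltnP r.+1 p; first by left; apply: PL.
  have -> : r.+1 = p by apply/eqP; rewrite eqn_leq lt_rp.
  by rewrite cartier_p; right; exists (L 0 v) => //; apply: PL.
have Wcoef w : W w -> frob_fixed p e (w 0%N).
  by case=> [Pw|[v Pv ->]]; [apply: Pe | apply: (Pe v 1%N)].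
have Gsub := generated_subring_subring W; have [G1 GB GM] := Gsub.
have Gfin := listable_generated charK e_gt0 Wfin Wcoef.
have GL := generated_subring_cartier charK perK WL.
have GDA : generated_subring W (D A).
  have -> : D A = D (hexp A) * hexp A ^+ p.-1.
    rewrite shift_hexp -mulrA -exprS prednK // (hurwitz_expp _ charK) hexp0.
    by rewrite expr1n hconst1 mulr1.
  apply: GM; first by apply: generated_subring_incl; right; exists (hexp A).
  apply: (@subringX _ _ _ _ Gsub).
  by apply: generated_subring_incl; left.
(* As A has no constant term, A = X DA. The set is stable because L_0 (X u) = X L_(p-1) u and
   L_(r+1) (X u) = L_r u. *)
exists (fun v => generated_subring W v \/ exists2 u, generated_subring W u & v = fps_mulX u).
split; first by apply: listableU => //; apply: listable_image.
- by right; exists (D A) => //; apply: fpsP => -[|n] //=.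
- move=> r v lt_rp [Gv|[u Gu ->]]; first by left; apply: GL.
  case: r lt_rp => [_|r lt_rp].
    right; exists (L p.-1 u); first by apply: GL; rewrite ?prednK.
    apply: fpsP => -[|n] /=; first by rewrite muln0 (pth_root0 perfK).
    by rewrite addn0 mulnS addnC -[p in (_ + p)%N](prednK p_gt0) addnS.
  left; have -> : cartier p r.+1 (fps_mulX u) = L r u by apply: fpsP => n; rewrite /= addnS.
  by apply: GL Gu; apply: ltnW.
Qed.

End AutomaticExp.

(** * Christol's theorem *)

Section FpsFrobenius.
Variables (K : fieldType) (p : nat).
Hypothesis perfK : perfect_exponent K p.
Let charK : p \in [pchar K]. Proof. by case: perfK. Qed.
Let p_prime : prime p. Proof. exact: pcharf_prime charK. Qed.
Let p_gt0 : (0 < p)%N. Proof. exact: prime_gt0. Qed.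
Local Notation phi := (@fps_of_poly K).
Local Notation L := (@cartier K p).
Implicit Types (A B E : fps K) (P Q : {poly K}).

Lemma fps_pchar : p \in [pchar fps K].
Proof.
apply/andP; split=> //; have /andP[_ /eqP p0] : p \in [pchar {poly K}] by rewrite pchar_poly.
by rewrite -(rmorph_nat phi) p0 rmorph0.
Qed.

Lemma fps_exppD A B : (A + B) ^+ p = A ^+ p + B ^+ p.
Proof. by apply: exprDn_pchar; rewrite -[p]expn1 pchar_nat_exp // fps_pchar. Qed.

Lemma fps_coefXnM n A i : (phi 'X^n * A) i = if (i < n)%N then 0 else A (i - n)%N.
Proof.
rewrite fps_coefM; case: ltnP => [lt_in|le_ni].
  rewrite big1 // => j _; rewrite /= coefXn ltn_eqF ?mul0r //.
  by rewrite (leq_ltn_trans _ lt_in) // -ltnS.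
have lt_ni : (n < i.+1)%N by [].
rewrite (bigD1 (Ordinal lt_ni)) //= coefXn eqxx mul1r big1 ?addr0 // => j ne_jn.
by rewrite coefXn (negbTE (ne_jn : j != n :> nat)) mul0r.
Qed.

Lemma fps_coefCM c A i : (phi c%:P * A) i = c * A i.
Proof.
rewrite fps_coefM big_ord_recl /= coefC subn0 big1 ?addr0 // => j _.
by rewrite coefC mul0r.
Qed.

Lemma fps_split A : A = phi (A 0%N)%:P + phi 'X * shift A.
Proof.
apply: fpsP => i; rewrite fps_coefD -['X]expr1 fps_coefXnM /= coefC.
by case: i => [|i] /=; rewrite ?addr0 // add0r subn1.
Qed.

Lemma fps_expp_split A : A ^+ p = phi (A 0%N ^+ p)%:P + phi 'X^p * shift A ^+ p.
Proof.
by rewrite [in LHS](fps_split A) fps_exppD exprMn polyC_exp !rmorphXn.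
Qed.

Lemma fps_coef_expp A n : (A ^+ p) n = if (p %| n)%N then A (n %/ p)%N ^+ p else 0.
Proof.
elim/ltn_ind: n A => n IH A; rewrite fps_expp_split fps_coefD fps_coefXnM /= coefC.
case: ltnP => [lt_np|le_pn].
  case: n {IH} lt_np => [|n] lt_np; first by rewrite dvdn0 div0n addr0.
  by rewrite gtnNdvd // addr0.
rewrite gtn_eqF ?(leq_trans p_gt0) // add0r IH; last by rewrite ltn_subrL p_gt0 (leq_trans p_gt0).
rewrite -[in RHS](subnK le_pn) dvdn_addl //; case: ifP => // _.
by rewrite divnDr // divnn p_gt0 addn1.
Qed.

(** Write E^p = e_0^p + X^p (shift E)^p: the factors e_0^p and X^p come out of L_r as e_0 and X, and
    the shift allows induction on the coefficient. *)
Lemma cartier_mul_expp r A E : (r < p)%N -> L r (A * E ^+ p) = L r A * E.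
Proof.
move=> lt_rp; have LE B n : L r B n = pth_root p (B (p * n + r)%N) by [].
have X1 B n : (phi 'X^1 * B) n.+1 = B n by rewrite fps_coefXnM subn1.
have LC c B : L r (phi (c ^+ p)%:P * B) = phi c%:P * L r B.
  by apply: fpsP => n; rewrite LE !fps_coefCM pth_rootM // pth_root_expp.
have LX B : L r (phi 'X^p * B) = phi 'X^1 * L r B.
  apply: fpsP => -[|n]; rewrite LE !fps_coefXnM ?muln0 ?lt_rp /= ?pth_root0 //.
  by rewrite mulnS -addnA ltnNge leq_addr /= addKn subn1.
apply: fpsP => n; elim: n E => [|n IH] E.
  rewrite fps_expp_split mulrDr (cartierD perfK) [A * _]mulrC [A * (_ * _)]mulrCA LC LX.
  rewrite fps_coefD fps_coefXnM addr0 fps_coefCM [in RHS](fps_split E) mulrDr fps_coefD.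
  by rewrite [L r A * phi _]mulrC mulrCA fps_coefCM -['X]expr1 fps_coefXnM addr0.
rewrite fps_expp_split mulrDr (cartierD perfK) [A * _]mulrC [A * (_ * _)]mulrCA LC LX.
rewrite fps_coefD X1 IH [in RHS](fps_split E) mulrDr fps_coefD.
by rewrite [L r A * phi _]mulrC mulrCA -['X]expr1 X1.
Qed.

Lemma fps_cartier_decomposition A : A = \sum_(r < p) phi 'X^r * (L r A) ^+ p.
Proof.
apply: fpsP => n; have lt_np : (n %% p < p)%N by rewrite ltn_mod.
(* Only the summand with index n mod p contributes to the coefficient of X^n. *)
have T (i : 'I_p) : (phi 'X^i * L i A ^+ p) n = if i == Ordinal lt_np then A n else 0.
  rewrite fps_coefXnM fps_coef_expp -val_eqE; case: ltnP => [lt_ni | le_in].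
    by case: eqP lt_ni => //= ->; rewrite ltnNge leq_mod.
  case: eqP => [/= ->|/eqP ne_i].
    have -> : (n - n %% p)%N = (n %/ p * p)%N by rewrite {1}(divn_eq n p) addnK.
    by rewrite dvdn_mull // mulnK //= (pth_rootK perfK) mulnC -divn_eq.
  rewrite ifN //; apply: contra ne_i => dvd_p; rewrite /= -[in (n %% p)%N](subnKC le_in) -modnDmr.
  by rewrite (eqP dvd_p) addn0 modn_small.
rewrite (big_morph (fun E : fps K => E n) (fun E F => fps_coefD E F n) (fps_coef0 _ n)).
by rewrite (eq_bigr _ (fun i _ => T i)) -big_mkcond big_pred1_eq.
Qed.

Definition poly_cartier r Q : {poly K} := \poly_(i < size Q) pth_root p Q`_(p * i + r).

Lemma coef_poly_cartier r Q i : (poly_cartier r Q)`_i = pth_root p Q`_(p * i + r).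
Proof.
rewrite coef_poly; case: ltnP => // le_Qi; rewrite nth_default ?pth_root0 //.
by rewrite (leq_trans le_Qi) // (leq_trans (leq_pmull i p_gt0)) // leq_addr.
Qed.

Lemma fps_of_poly_cartier r Q : L r (phi Q) = phi (poly_cartier r Q).
Proof. by apply: fpsP => i; rewrite /= coef_poly_cartier. Qed.

End FpsFrobenius.

(** * Linear dependence and denominators *)

Lemma exists_kernel_row (F : fieldType) (m n : nat) (M : 'M[F]_(m, n)) :
  (n < m)%N -> exists2 u : 'rV_m, u != 0 & u *m M = 0.
Proof.
move=> lt_nm; have kM : kermx M != 0.
  by rewrite kermx_eq0 /row_free ltn_eqF // (leq_ltn_trans (rank_leq_col M)).
exists (nz_row (kermx M)); first by rewrite nz_row_eq0.
by apply/eqP; rewrite -sub_kermx nz_row_sub.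
Qed.

(* The residues of the X^(e i) modulo a polynomial killing x are linearly dependent. *)
Lemma algebraic_power_relation (F E : fieldType) (f : {rmorphism F -> E}) (x : E)
    (e : nat -> nat) : algebraicOver f x ->
  exists m, exists2 u : 'rV[F]_m, u != 0 & \sum_(i < m) f (u 0 i) * x ^+ e i = 0.
Proof.
case=> g g0 gx; set d := (size g).-1.
have [|u u0 uM] := @exists_kernel_row F d.+1 d (\matrix_(i < d.+1, j < d) ('X^(e i) %% g)`_j).
  exact: ltnSn.
exists d.+1, u => //; set h := \sum_(i < d.+1) u 0 i *: 'X^(e i).
have -> : \sum_(i < d.+1) f (u 0 i) * x ^+ e i = (map_poly f h).[x].
  rewrite /h rmorph_sum horner_sum; apply: eq_bigr => i _.
  by rewrite /= map_polyZ map_polyXn hornerZ hornerXn.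
suff /dvdpP[q ->] : g %| h by rewrite rmorphM hornerM (eqP gx) mulr0.
apply/modp_eq0P; apply/polyP => j; rewrite coef0.
have -> : h %% g = \sum_(i < d.+1) (u 0 i *: 'X^(e i)) %% g.
  apply: (big_morph (fun a : {poly F} => a %% g)); last exact: mod0p.
  by move=> a b; apply: modpD.
have [lt_jd|le_dj] := ltnP j d.
  have /rowP/(_ (Ordinal lt_jd)) := uM; rewrite !mxE => uMj.
  rewrite -[RHS]uMj coef_sum.
  by apply: eq_bigr => i _; rewrite mxE modpZl coefZ.
rewrite coef_sum big1 // => i _; rewrite modpZl coefZ nth_default ?mulr0 //.
have lt_g : (size ('X^(e i) %% g)%R < size g)%N by rewrite ltn_modp.
by apply: leq_trans le_dj; rewrite -ltnS (leq_trans lt_g) ?leqSpred.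
Qed.

Lemma ratfun_common_denominator (K : fieldType) (m : nat) (u : 'I_m -> ratfun K) :
  exists2 c : {poly K}, c != 0 &
    exists P : 'I_m -> {poly K}, forall i, FracField.tofrac c * u i = FracField.tofrac (P i).
Proof.
have uE i : u i = FracField.tofrac \n_(repr (u i)) / FracField.tofrac \d_(repr (u i)).
  by rewrite -tofrac_ratio reprK.
have d0 i : \d_(repr (u i)) != 0 := denom_ratioP _.
exists (\prod_i \d_(repr (u i))); first by apply/prodf_neq0.
exists (fun i => \n_(repr (u i)) * \prod_(j | j != i) \d_(repr (u j))) => i.
rewrite (bigD1 i) //= !tofracM; move: (uE i) (d0 i).
move: (\n_(repr (u i))) (\d_(repr (u i))) => a b -> b0; rewrite mulrC -mulrA; congr (_ * _).
by rewrite mulKf ?tofrac_eq0.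
Qed.

Section Christol.
Variables (K : fieldType) (p : nat).
Hypotheses (charK : p \in [pchar K]) (perK : frob_periodic K p).
Let p_prime : prime p. Proof. exact: pcharf_prime charK. Qed.
Let p_gt0 : (0 < p)%N. Proof. exact: prime_gt0. Qed.
Let perfK := frob_periodic_perfect charK perK.
Local Notation phi := (@fps_of_poly K).
Local Notation L := (@cartier K p).
Local Notation iota := (@ratfun_to_laurent K).
Implicit Types (A B E : fps K) (P Q : {poly K}).

Lemma algebraic_frobenius_relation A : fps_algebraic A ->
  exists m, exists2 P : nat -> {poly K}, (exists2 i, (i < m)%N & P i != 0) &
    \sum_(i < m) phi (P i) * A ^+ (p ^ i) = 0.
Proof.
move=> /(algebraic_power_relation (fun i => (p ^ i)%N))[m [u u0 uA]].
have [c c0 [P cuP]] := ratfun_common_denominator (fun i => u 0 i).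
exists m, (fun i => if insub i is Some j then P j else 0).
  have [j uj] : exists j, u 0 j != 0.
    by apply/rV0Pn.
  exists j => //; rewrite valK -tofrac_eq0 -cuP mulf_neq0 ?tofrac_eq0 //.
apply/eqP; rewrite -tofrac_eq0 rmorph_sum /=.
transitivity (iota (FracField.tofrac c) * \sum_(i < m) iota (u 0 i) * fps_to_laurent A ^+ (p ^ i) == 0).
  congr (_ == _); rewrite mulr_sumr; apply: eq_bigr => i _.
  by rewrite valK mulrA -rmorphM cuP /= ratfun_to_laurent_poly rmorphM rmorphXn.
by rewrite uA mulr0 eqxx.
Qed.

(** If P_0 = 0, every power of A in the relation is a p-th power, so an operator L_r lowers each
    exponent p^(i+1) to p^i and shortens the relation. *)
Lemma separable_frobenius_relation A m (P : nat -> {poly K}) :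
    (exists2 i, (i < m)%N & P i != 0) -> \sum_(i < m) phi (P i) * A ^+ (p ^ i) = 0 ->
  exists n, exists2 Q : nat -> {poly K}, Q 0%N != 0 &
    \sum_(i < n.+1) phi (Q i) * A ^+ (p ^ i) = 0.
Proof.
elim: m P => [|m IH] P [k lt_km Pk] PA; first by [].
have [P0|P0] := eqVneq (P 0%N) 0; last by exists m, P.
case: k lt_km Pk => [|k] lt_km Pk; first by rewrite P0 eqxx in Pk.
have [j Pkj] : exists j, (P k.+1)`_j != 0.
  by exists (size (P k.+1)).-1; rewrite -lead_coefE lead_coef_eq0.
(* With r = j mod p, the nonzero coefficient of index j survives in L_r of that polynomial, so the
   shorter relation is nontrivial. *)
have lt_jp : (j %% p < p)%N by rewrite ltn_mod.
apply: (IH (fun i => poly_cartier p (j %% p) (P i.+1))).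
  exists k => //; apply: contraNneq Pkj => /(congr1 (fun Q : {poly K} => Q`_(j %/ p))).
  rewrite (coef_poly_cartier perfK) coef0 mulnC -divn_eq => root0.
  by rewrite -(pth_rootK perfK (P k.+1)`_j) root0 expr0n gtn_eqF.
have := congr1 (L (j %% p)) PA.
rewrite big_ord_recl P0 rmorph0 mul0r add0r (cartier_sum perfK).
have -> : L (j %% p) 0 = 0.
  by apply: fpsP => i /=; rewrite (pth_root0 perfK).
move=> LPA; rewrite -[RHS]LPA; apply: eq_bigr => i _.
by rewrite lift0 expnSr exprM (cartier_mul_expp perfK) // (fps_of_poly_cartier perfK).
Qed.

Lemma listable_poly (F : K -> Prop) d : listable F ->
  listable (fun Q : {poly K} => (size Q <= d)%N /\ forall i, F Q`_i).
Proof.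
move=> Ffin; apply: (@listable_sub _ _ (fun Q => exists2 f : {ffun 'I_d -> K},
    (forall i, F (f i)) & Q = \sum_(i < d) f i *: 'X^i)).
  move=> Q [sQ FQ]; exists [ffun i : 'I_d => Q`_i] => [i|]; first by rewrite ffunE.
  apply/polyP => j; rewrite coef_sum.
  have [lt_jd|le_dj] := ltnP j d.
    rewrite (bigD1 (Ordinal lt_jd)) //= ffunE coefZ coefXn eqxx mulr1 big1 ?addr0 // => i ne_ij.
    by rewrite coefZ coefXn eq_sym (negbTE (ne_ij : i != j :> nat)) mulr0.
  rewrite nth_default ?(leq_trans sQ) // big1 // => i _.
  by rewrite coefZ coefXn gtn_eqF ?mulr0 // (leq_trans (ltn_ord i)).
exact/listable_image/listable_ffun.
Qed.

Lemma algebraic_automatic A : fps_algebraic A -> automatic p A.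
Proof.
case/algebraic_frobenius_relation=> m' [P' Pn0 PA'].
have [m [P P0 PA]] := separable_frobenius_relation Pn0 PA' => {m' P' Pn0 PA'}.
have [e e_gt0 Pe] : exists2 e, (0 < e)%N &
    forall (i : 'I_m.+1) j, frob_fixed p e (P i)`_j.
  have [e e_gt0 se] := frob_fixed_seq perK (flatten [seq (P (i : 'I_m.+1) : seq K) | i <- enum 'I_m.+1]).
  exists e => // i j; have [lt_j|le_j] := ltnP j (size (P i)).
    apply: se; apply/flattenP; exists (P i : seq K); last exact: mem_nth.
    by apply/mapP; exists i; rewrite ?mem_enum.
  by rewrite nth_default // /frob_fixed expr0n expn_eq0 gtn_eqF.
have Fsub := frob_fixed_subring charK e; have [F1 FB FM] := Fsub.
pose d := \max_(i < m.+1) size (P i).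
have Pd (i : 'I_m.+1) : (size (P i) <= d.+1)%N by rewrite leqW // (leq_bigmax i).
pose F (Q : {poly K}) := forall i, frob_fixed p e Q`_i.
pose S Q := (size Q <= d.+1)%N /\ F Q.
have F_M Q1 Q2 : F Q1 -> F Q2 -> F (Q1 * Q2).
  move=> F1' F2 i; rewrite coefM; apply: (@subring_sum _ _ _ _ _ _ Fsub) => j _; exact: FM.
have F_X Q n : F Q -> F (Q ^+ n).
  move=> FQ; elim: n => [|n IH]; last by rewrite exprS; apply: F_M.
  by move=> i; rewrite expr0 coef1; case: eqP => // _; apply: (subring0 Fsub).
have dM n1 n2 Q1 Q2 : (size Q1 <= n1.+1)%N -> (size Q2 <= n2.+1)%N ->
    (size (Q1 * Q2)%R <= (n1 + n2).+1)%N.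
  by move=> s1 s2; apply: leq_trans (size_polyMleq _ _) _; lia.
have dX n Q : (size Q <= d.+1)%N -> (size (Q ^+ n)%R <= (n * d).+1)%N.
  move=> sQ; elim: n => [|n IH]; first by rewrite expr0 size_poly1.
  by rewrite exprS mulSn; apply: dM.
have phiP0 : phi (P 0%N) != 0 by rewrite (raddf_eq0 _ (@fps_of_poly_inj K)).
(* The stable set consists of the quotients (sum of Q_i A^(p^i)) / P_0 with Q_i of degree at most d
   over a fixed finite field; as P_0 is nonzero, Q determines v. *)
pose rel (Q : {ffun 'I_m.+1 -> {poly K}}) (v : fps K) :=
  phi (P 0%N) * v = \sum_i phi (Q i) * A ^+ (p ^ i).
exists (fun v => exists2 Q : {ffun 'I_m.+1 -> {poly K}}, (forall i, S (Q i)) & rel Q v); split.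
- apply: listable_rel => [Q v v' Qv Qv'|].
    by apply: (mulfI phiP0); rewrite Qv Qv'.
  exact/listable_ffun/listable_poly/listable_frob_fixed.
- exists [ffun i : 'I_m.+1 => if i == ord0 then P 0%N else 0].
    move=> i; rewrite ffunE; case: eqP => _; first by split; [apply: (Pd ord0) | apply: (Pe ord0)].
    by split=> [|j]; rewrite ?size_poly0 // coef0; apply: (subring0 Fsub).
  rewrite /rel (bigD1 ord0) //= ffunE eqxx expn0 expr1 big1 ?addr0 // => i i0.
  by rewrite ffunE (negbTE i0) rmorph0 mul0r.
move=> r v lt_rp [Q SQ Qv].
(* Subtracting a multiple of the relation PA removes the term in A itself, so that all
   remaining powers of A are p-th powers, which come out of L r. *)
pose T (i : 'I_m.+1) : {poly K} := P 0%N ^+ p.-1 * Q i - P 0%N ^+ p.-2 * Q ord0 * P i.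
have p2 : p.-1 = p.-2.+1 by case: (p) (prime_gt1 p_prime) => [|[]].
have T0 : T ord0 = 0.
  by rewrite /T p2 exprSr mulrAC subrr.
have TA : v * phi (P 0%N) ^+ p = \sum_(i < m.+1) phi (T i) * A ^+ (p ^ i).
  under eq_bigr => i _ do rewrite rmorphB !rmorphM mulrBl -!mulrA.
  rewrite sumrB -!mulr_sumr PA !mulr0 subr0 -Qv rmorphXn.
  by rewrite mulrC -[in LHS](prednK p_gt0) exprSr -mulrA.
have FT i : F (T i).
  have [_ FQi] := SQ i; have [_ FQ0] := SQ ord0; have FP0 := Pe ord0.
  have FT1 : F (P 0%N ^+ p.-1 * Q i) := F_M _ _ (F_X _ _ FP0) FQi.
  have FT2 : F (P 0%N ^+ p.-2 * Q ord0 * P i) := F_M _ _ (F_M _ _ (F_X _ _ FP0) FQ0) (Pe i).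
  by move=> j; rewrite coefB; apply: FB.
(* L_r divides degrees by p, so the bound p d for [T] returns to d. *)
have dT i : (size (T i) <= (p * d).+1)%N.
  have [sQi _] := SQ i; have [sQ0 _] := SQ ord0.
  apply: leq_trans (size_polyD _ _) _; rewrite size_polyN geq_max.
  have -> : (p * d = p.-1 * d + d)%N by rewrite -{1}(prednK p_gt0) mulSn addnC.
  rewrite dM ?dX ?(Pd ord0) //= p2 mulSn [(d + _)%N]addnC.
  by rewrite dM ?(Pd i) // dM // dX // (Pd ord0).
(* Since T_0 = 0, indices move down by one: L_r turns T_(i+1) A^(p^(i+1)) into (L_r T_(i+1))
   A^(p^i), and the last slot becomes 0. The factor P_0^p comes out as P_0. *)
exists [ffun i : 'I_m.+1 => if (insub i.+1 : option 'I_m.+1) is Some j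
    then poly_cartier p r (T j) else 0 : {poly K}].
  move=> i; rewrite ffunE; case: insubP => [j _ _|_]; last first.
    by split=> [|j]; rewrite ?size_poly0 // coef0; apply: (subring0 Fsub).
  split=> [|k]; last by rewrite (coef_poly_cartier perfK); apply: (frob_fixed_root charK perK); apply: FT.
  apply/leq_sizeP => k lt_dk; rewrite (coef_poly_cartier perfK) nth_default ?(pth_root0 perfK) //.
  apply: leq_trans (dT j) _; apply: leq_trans (leq_addr _ _).
  by rewrite ltn_mul2l p_gt0.
rewrite /rel mulrC -(cartier_mul_expp perfK) // TA (cartier_sum perfK).
rewrite big_ord_recl T0 rmorph0 mul0r.
have -> : L r 0 = 0 by apply: fpsP => i /=; rewrite (pth_root0 perfK).
rewrite add0r [RHS]big_ord_recr /= ffunE insubF ?ltnn // rmorph0 mul0r addr0.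
apply: eq_bigr => i _; rewrite ffunE.
rewrite insubT /=; first by rewrite ltnS.
move=> lt_im; rewrite expnSr exprM (cartier_mul_expp perfK) // (fps_of_poly_cartier perfK).
by congr (phi (poly_cartier p r (T _)) * _); apply: val_inj.
Qed.

Definition frobenius_span n (s : 'I_n -> fps K) (t : nat) (x : fps K) : Prop :=
  exists N : 'I_n -> {poly K}, x = \sum_i phi (N i) * s i ^+ (p ^ t).

(** Each member of the stable set is a K[X]-combination of p-th powers of members. By iteration the
    n + 1 series A^(p^t), t = 0, ..., n, lie in the span of the n series v_i^(p^n), so they are
    linearly dependent over K(X). *)
Lemma automatic_algebraic A : automatic p A -> fps_algebraic A.
Proof.
case=> P [[s0 s0P] PA PL]; pose s := [seq v <- s0 | `[< P v >]].
have sP v : (v \in s) <-> P v.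
  by rewrite mem_filter; split=> [/andP[/asboolP]|Pv] //; rewrite s0P // andbT; apply/asboolP.
pose n := size s; pose v_ (i : 'I_n) := tnth (in_tuple s) i.
have v_P v : P v -> exists i, v = v_ i.
  by move=> /sP v_s; have /tnthP[i ->] : v \in in_tuple s := v_s; exists i.
have Pv_ i : P (v_ i) by apply/sP/(mem_tnth i (in_tuple s)).
pose Span := frobenius_span v_.
have Span0 t : Span t 0 by exists (fun=> 0); rewrite big1 // => i _; rewrite rmorph0 mul0r.
have SpanD t x y : Span t x -> Span t y -> Span t (x + y).
  case=> [N ->] [M ->]; exists (fun i => N i + M i); rewrite -big_split.
  by apply: eq_bigr => i _; rewrite rmorphD mulrDl.
have SpanM t Q x : Span t x -> Span t (phi Q * x).
  case=> [N ->]; exists (fun i => Q * N i); rewrite mulr_sumr.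
  by apply: eq_bigr => i _; rewrite rmorphM mulrA.
have Span_sum t (I : finType) (f : I -> fps K) : (forall i, Span t (f i)) -> Span t (\sum_i f i).
  by move=> Sf; apply: (big_ind (Span t)) => // x y; apply: SpanD.
have Span_v t i : Span t (v_ i ^+ (p ^ t)).
  exists (fun j => (j == i)%:R); rewrite (bigD1 i) //= eqxx rmorph1 mul1r big1 ?addr0 // => j ne_ji.
  by rewrite (negbTE ne_ji) rmorph0 mul0r.
have SpanF t x : Span t x -> Span t.+1 (x ^+ p).
  case=> [N ->]; exists (fun i => N i ^+ p).
  have -> : (\sum_i phi (N i) * v_ i ^+ (p ^ t)) ^+ p = \sum_i (phi (N i) * v_ i ^+ (p ^ t)) ^+ p.
    apply: (big_morph (fun x : fps K => x ^+ p) (fps_exppD perfK)).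
    by rewrite expr0n gtn_eqF.
  by apply: eq_bigr => i _; rewrite exprMn rmorphXn -exprM -expnSr.
have Span1 v : P v -> Span 1%N v.
  move=> Pv; rewrite [v](fps_cartier_decomposition perfK); apply: Span_sum => i; apply: SpanM.
  have [j ->] := v_P _ (PL _ _ (ltn_ord i) Pv).
  exact: (Span_v 1%N).
have Span_vF t i : Span t.+1 (v_ i ^+ (p ^ t)).
  elim: t => [|t IH]; first by rewrite expn0 expr1; apply: Span1.
  by rewrite expnSr exprM; apply: SpanF.
have SpanS t x : Span t x -> Span t.+1 x.
  by case=> [N ->]; apply: Span_sum => i; apply: SpanM.
have Span_le t t' x : (t <= t')%N -> Span t x -> Span t' x.
  move=> /subnKC <-; elim: (t' - t)%N => [|k IH] Sx; rewrite ?addn0 // addnS.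
  exact/SpanS/IH.
have SpanA (t : 'I_n.+1) : Span n (A ^+ (p ^ t)).
  have [i ->] := v_P _ PA; apply: (@Span_le t); first by rewrite -ltnS.
  exact: Span_v.
have [N NE] := choice SpanA.
have [u u0 uM] := @exists_kernel_row (ratfun K) n.+1 n
  (\matrix_(t < n.+1, i < n) FracField.tofrac (N t i)) (ltnSn n).
(* The exponents p^t are distinct, so a nonzero row [u] gives a nonzero polynomial. *)
exists (\sum_t u 0 t *: 'X^(p ^ t)).
  have /rV0Pn[t ut] := u0; apply: contraNneq ut => /(congr1 (fun Q : {poly ratfun K} => Q`_(p ^ t))).
  rewrite coef0 coef_sum (bigD1 t) //= coefZ coefXn eqxx mulr1 big1 ?addr0 => [->//|i ne_it].
  by rewrite coefZ coefXn eqn_exp2l ?prime_gt1 // eq_sym (negbTE (ne_it : i != t :> nat)) mulr0.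
rewrite rootE rmorph_sum horner_sum /=.
transitivity (\sum_(i < n) iota ((u *m \matrix_(t, i) FracField.tofrac (N t i)) 0 i)
  * fps_to_laurent (v_ i ^+ (p ^ n)) == 0); last first.
  by rewrite uM big1 ?eqxx // => i _; rewrite mxE rmorph0 mul0r.
congr (_ == _); under [RHS]eq_bigr => i _ do rewrite mxE rmorph_sum mulr_suml.
rewrite exchange_big; apply: eq_bigr => t _ /=.
rewrite map_polyZ map_polyXn hornerZ hornerXn -rmorphXn NE rmorph_sum mulr_sumr.
apply: eq_bigr => i _; rewrite mxE !rmorphM /= ratfun_to_laurent_poly.
by rewrite mulrA.
Qed.

End Christol.

(** * Elements algebraic over the prime field, and the equivalence *)

Lemma expp_pchar_inj (F : fieldType) p i :
  p \in [pchar F] -> injective (fun x : F => x ^+ (p ^ i)).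
Proof.
move=> charF; elim: i => [|i IH] x y /=; first by rewrite expn0.
rewrite expnS !exprM => /IH; exact: (fmorph_inj (pFrobenius_aut charF)).
Qed.

(** There are finitely many residues modulo [g] over F_p, so two of the X^(p^i) have the same one;
    injectivity of Frobenius then cancels the smaller exponent. *)
Lemma algebraic_Fp_periodic p (F : fieldType) (f : {rmorphism 'F_p -> F}) (x : F) :
  prime p -> algebraicOver f x -> exists2 e, (0 < e)%N & x ^+ (p ^ e) = x.
Proof.
move=> p_prime [g g0 gx].
have charF : p \in [pchar F] by rewrite (fmorph_pchar f) pchar_Fp.
pose h i : {poly 'F_p} := 'X^(p ^ i) %% g.
have hx i : x ^+ (p ^ i) = (map_poly f (h i)).[x].
  rewrite -hornerXn -(map_polyXn f) [in LHS](divp_eq 'X^(p ^ i) g).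
  by rewrite rmorphD rmorphM hornerD hornerM (eqP gx) mulr0 add0r.
have [s sP] : listable (fun Q : {poly 'F_p} => (size Q <= size g)%N /\ forall i : nat, True).
  by apply: (@listable_poly _ (fun=> True)); exists (enum 'F_p) => c _; rewrite mem_enum.
have hs i : h i \in s by apply: sP; rewrite ltnW // ltn_modp.
have [i [j [lt_ij hij]]] : exists i j, (i < j)%N /\ h i = h j.
  apply: contrapT => h_inj.
  have : (size [seq h i | i <- iota 0 (size s).+1] <= size s)%N.
    apply: uniq_leq_size => [|_ /mapP[i _ ->] //].
    rewrite map_inj_uniq ?iota_uniq // => i j hij.
    by case: (ltngtP i j) => // lt_ij; case: h_inj; [exists i, j | exists j, i].
  by rewrite size_map size_iota ltnn.
exists (j - i)%N; first by rewrite subn_gt0.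
apply: (@expp_pchar_inj _ _ i charF (x ^+ (p ^ (j - i))) x); rewrite /= -exprM -expnD subnK 1?ltnW //.
by rewrite !hx hij.
Qed.

Theorem theorem1p3 (p : nat) (p_prime : prime p)
    (Fpbar : closedFieldType) (iota : {rmorphism 'F_p -> Fpbar})
    (Fpbar_alg : forall x : Fpbar, algebraicOver iota x)
    (subK : {pred Fpbar}) (K : subFieldType subK)
    (A : fps K) (A_m : A 0%N = 0) :
  fps_algebraic A <-> fps_algebraic (exp_fact A).
Proof.
have charK : p \in [pchar K].
  by rewrite -(fmorph_pchar (val : {rmorphism K -> Fpbar})) (fmorph_pchar iota) pchar_Fp.
(* Periodicity holds in the algebraic closure and is pulled back along the injective [val]. *)
have perK : frob_periodic K p.
  move=> c; have [e e_gt0 ce] := algebraic_Fp_periodic p_prime (Fpbar_alg (val c)).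
  by exists e => //; apply: val_inj; rewrite -[RHS]ce rmorphXn.
rewrite exp_factE; split=> /(algebraic_automatic charK perK) autA.
  exact/(automatic_algebraic charK perK)/(automatic_hexp charK perK).
exact/(automatic_algebraic charK perK)/(automatic_hexp_inv charK perK).
Qed.
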